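(* Let $s$ be a positive integer. For every $\varepsilon>0$, there exists $\gamma>0$ such that the following holds for every $D$. If $G$ is a multipartite graph with a partition $\mathcal{P}=(V_1,V_2,\ldots,V_r)$, where $\overline{D}_{\mathcal{P}}(G)\le D$, $\Gamma_{\mathcal{P}}(G)\le \gamma D$, and $\mathcal{P}$ is $(s+\varepsilon)D$-thick, then $G$ has an independent transversal blow-up of size $s$ with respect to $\mathcal{P}$.
   Context: A multipartite graph $G$ with partition $\mathcal{P}=(V_1,\ldots,V_r)$ is a graph whose vertex set is the disjoint union of the blocks $V_1,\ldots,V_r$, each of which is an independent set of $G$. The partition $\mathcal{P}$ is $x$-thick if $|V_i|\ge x$ for every $i\in[r]$. The average degree of a block is $\overline{d}_G(V_i)=\frac{1}{|V_i|}\sum_{v\in V_i}d_G(v)$, and the maximum block average degree is $\overline{D}_{\mathcal{P}}(G)=\max_{i\in[r]}\overline{d}_G(V_i)$. The local degree is $\Gamma_{\mathcal{P}}(G)=\max_{v\in V(G)}\max_{i\in[r]}d_G(v,V_i)$, where $d_G(v,V_i)$ is the number of neighbours of $v$ in $V_i$. An independent transversal blow-up of size $s$ with respect to $\mathcal{P}$ is an independent set of $G$ consisting of exactly $s$ vertices from each block $V_i$.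
   Formalization: When D < 1, where thickness alone can leave blocks with fewer than s vertices and the claim fails (edgeless graph, one-vertex blocks, s = 2, D = 1/10), it is additionally assumed that every block has at least s vertices; for D ≥ 1 nothing is added. *)

(* Defs.v *)
From mathcomp Require Import all_boot all_order all_algebra.
From mathcomp Require Import reals.

Set Implicit Arguments.
Unset Strict Implicit.
Unset Printing Implicit Defensive.

Import Order.TTheory GRing.Theory Num.Theory.
Local Open Scope ring_scope.

Definition simple_graph (T : finType) (e : rel T) : Prop :=
  symmetric e /\ irreflexive e.

Definition independent (T : finType) (e : rel T) (A : {set T}) : Prop :=
  {in A &, forall u v, ~~ e u v}.

(* The blocks are an indexed family: pairwise disjointness, rather than
   [partition] of a set of sets, also keeps two empty blocks distinct. *)
Definition multipartition (T : finType) (e : rel T) (r : nat)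
    (V : 'I_r -> {set T}) : Prop :=
  [/\ \bigcup_(i < r) V i = [set: T],
      forall i j : 'I_r, i != j -> [disjoint V i & V j]
    & forall i : 'I_r, independent e (V i)].

Definition deg (T : finType) (e : rel T) (v : T) : nat :=
  #|[set w | e v w]|.

Definition deg_in (T : finType) (e : rel T) (v : T) (A : {set T}) : nat :=
  #|[set w in A | e v w]|.

(* Equal to 0 on the empty block, since 0^-1 = 0. *)
Definition avg_deg (R : realType) (T : finType) (e : rel T) (A : {set T}) : R :=
  (\sum_(v in A) (deg e v)%:R) / #|A|%:R.

(* Average degrees are nonnegative, so the default value 0 only matters when
   there are no blocks. *)
Definition max_avg_deg (R : realType) (T : finType) (e : rel T) (r : nat)
    (V : 'I_r -> {set T}) : R :=
  \big[Num.max/0]_(i < r) avg_deg R e (V i).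

Definition local_deg (T : finType) (e : rel T) (r : nat)
    (V : 'I_r -> {set T}) : nat :=
  (\max_(v : T) \max_(i < r) deg_in e v (V i))%N.

Definition thick (R : realType) (T : finType) (r : nat)
    (V : 'I_r -> {set T}) (x : R) : Prop :=
  forall i : 'I_r, x <= #|V i|%:R.

Definition transversal_blowup (T : finType) (e : rel T) (r : nat)
    (V : 'I_r -> {set T}) (s : nat) (S : {set T}) : Prop :=
  independent e S /\ forall i : 'I_r, #|S :&: V i| = s.

(* Main.v *)
Require Import Defs.
From mathcomp Require Import all_boot all_order all_algebra.
From mathcomp Require Import reals.
From mathcomp Require Import sequences exp ring lra.

(** A blow-up of size s is a transversal of the graph in which every block is
    replaced by s copies of itself, the copies of a vertex being made adjacent,
    so it suffices to find transversals of graphs whose blocks have size n, with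
    block degree sums at most (1 - beta) n^2, maximum degree O(n) and local
    degree at most a small multiple of n; the maximum degree is under control
    once each block has been cut down to its vertices of least degree.

    First, blocks are shrunk by random choice of one vertex in each of n / 8
    groups of 8.  All relative degrees are preserved up to n^(-1/3), and these
    errors form a geometric series, so the process can run until n is a large
    constant, when the local degree has dropped to O(n^(2/3)).

    Then the blocks are split at random into m classes over which the degree of
    every vertex is evenly distributed, and the classes are coloured one after
    the other, each time choosing a uniformly random remaining vertex in every
    block of the class.  If blocks have average degree a n, a fraction
    1 - a c / m of each block survives the first c classes.  Edges inside one
    class are rare but cannot be ignored: they are avoided with the local lemma,
    together with the failures of concentration.  As these failures depend on
    far too many choices for the usual lemma, it is applied with Chernoff
    bounds in place of probabilities: the expectation of a product over a set
    of blocks grows under conditioning by a bounded factor per block, so the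
    Chernoff bound survives with a slightly larger mean. *)

Set Implicit Arguments.
Unset Strict Implicit.
Unset Printing Implicit Defensive.

Import Order.TTheory GRing.Theory Num.Theory.
Local Open Scope ring_scope.

(** * The local lemma *)

Section ProductExpectation.
Variables (R : realFieldType) (B X : finType) (mu : B -> X -> R).
Hypothesis mu_ge0 : forall j x, 0 <= mu j x.
Hypothesis mu_sum1 : forall j, \sum_x mu j x = 1.

Definition weight (w : {ffun B -> X}) : R := \prod_j mu j (w j).

Definition expect (f : {ffun B -> X} -> R) : R := \sum_w weight w * f w.

Definition depends_on (Y : Type) (J : {set B}) (f : {ffun B -> X} -> Y) : Prop :=
  forall w w' : {ffun B -> X}, {in J, w =1 w'} -> f w = f w'.

Lemma weight_ge0 w : 0 <= weight w.
Proof. by apply: prodr_ge0 => j _. Qed.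

Lemma le_expect f g : (forall w, f w <= g w) -> expect f <= expect g.
Proof.
by move=> lefg; apply: ler_sum => w _; apply: ler_wpM2l (weight_ge0 w) _ _ (lefg w).
Qed.

Lemma eq_expect f g : f =1 g -> expect f = expect g.
Proof. by move=> fg; apply: eq_bigr => w _; rewrite fg. Qed.

Lemma expectZ a f : expect (fun w => a * f w) = a * expect f.
Proof. by rewrite /expect mulr_sumr; apply: eq_bigr => w _; rewrite mulrCA. Qed.

Lemma expectB f g : expect (fun w => f w - g w) = expect f - expect g.
Proof. by rewrite /expect -sumrB; apply: eq_bigr => w _; rewrite mulrBr. Qed.

Lemma expect_sum (I : finType) (P : pred I) (f : I -> {ffun B -> X} -> R) :
  expect (fun w => \sum_(i | P i) f i w) = \sum_(i | P i) expect (f i).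
Proof.
by rewrite /expect exchange_big; apply: eq_bigr => w _; rewrite mulr_sumr.
Qed.

Lemma expect_prod (h : B -> X -> R) :
  expect (fun w => \prod_j h j (w j)) = \prod_j \sum_x mu j x * h j x.
Proof. by rewrite bigA_distr_bigA; apply: eq_bigr => w _; rewrite -big_split. Qed.

Lemma expect1 : expect (fun=> 1) = 1.
Proof.
have := expect_prod (fun _ _ => 1); rewrite (eq_expect (g := fun=> 1)).
  by move=> ->; rewrite big1 // => j _; under eq_bigr do rewrite mulr1.
by move=> w; rewrite big1.
Qed.

Let mix (J : {set B}) (w w' : {ffun B -> X}) : {ffun B -> X} :=
  [ffun j => if j \in J then w j else w' j].

(** For two independent copies of the sample, exchanging the coordinates in [J] preserves the joint
    weight and turns [f w * g w] into [f w * g w']. *)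
Lemma expectM_indep (J : {set B}) f g :
  depends_on J f -> depends_on (~: J) g ->
  expect (fun w => f w * g w) = expect f * expect g.
Proof.
move=> fJ gJ; rewrite -[LHS]mulr1 -[X in _ * X = _]expect1 /expect !big_distrlr /= !pair_big /=.
pose swap p := (mix J p.1 p.2, mix J p.2 p.1).
have swapK : involutive swap.
  by case=> w w'; rewrite /swap /=; congr pair; apply/ffunP=> j;
    rewrite !ffunE; case: (j \in J).
rewrite (reindex_inj (inv_inj swapK)); apply: eq_bigr => -[w w'] _ /=.
rewrite (fJ _ w); last by move=> j jJ; rewrite ffunE jJ.
rewrite (gJ _ w'); last by move=> j; rewrite inE ffunE => /negPf ->.
have -> : weight (mix J w w') * (f w * g w') * (weight (mix J w' w) * 1) =
  (weight (mix J w w') * weight (mix J w' w)) * (f w * g w') by ring.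
have -> : weight (mix J w w') * weight (mix J w' w) = weight w * weight w'.
  rewrite /weight -!big_split; apply: eq_bigr => j _ /=; rewrite !ffunE.
  by case: ifP => // _; rewrite mulrC.
by ring.
Qed.

End ProductExpectation.

Section LocalLemma.
Variables (R : realFieldType) (B X E : finType) (mu : B -> X -> R).
Hypothesis mu_ge0 : forall j x, 0 <= mu j x.
Hypothesis mu_sum1 : forall j, \sum_x mu j x = 1.

Variables (A : E -> pred {ffun B -> X}) (scope : E -> {set B}).
Variables (kap : E -> R) (u : E -> B -> R) (h : E -> B -> X -> R) (alpha tau : R).
Hypothesis A_scope : forall e, depends_on (scope e) (A e).
Hypothesis kap_ge0 : forall e, 0 <= kap e.
Hypothesis u_ge0 : forall e j, 0 <= u e j.
Hypothesis h_ge0 : forall e j x, 0 <= h e j x.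
(** A certificate of product form stands in for the probability of [A e]. Under conditioning the
    constant part [u] is unaffected, and only the random part [h] pays the factor [alpha]. *)
Hypothesis A_cert :
  forall e w, (A e w)%:R <= kap e * \prod_j (u e j + h e j (w j)).

(* Bounds the probability of [A e] conditioned on avoiding any set of events. *)
Definition lll_bound e : R :=
  kap e * \prod_j (u e j + alpha * \sum_x mu j x * h e j x).

Hypothesis tau_lt1 : tau < 1.
Hypothesis alphaE : alpha * (1 - tau) = 1.
Hypothesis bound_le : forall e, lll_bound e <= tau.
Hypothesis bound_sum : forall j, \sum_(e | j \in scope e) lll_bound e <= tau.

Let avoid (S : {set E}) w : R := [forall e in S, ~~ A e w]%:R.
Let pavoid S := expect mu (avoid S).

Let alpha_gt0 : 0 < alpha.
Proof.
have h1 : 0 < 1 - tau by rewrite subr_gt0.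
by rewrite -(pmulr_lgt0 _ h1) alphaE ltr01.
Qed.

Let bound_ge0 e : 0 <= lll_bound e.
Proof.
apply: mulr_ge0 (kap_ge0 e) _; apply: prodr_ge0 => j _.
apply: addr_ge0 (u_ge0 e j) _; apply: mulr_ge0 (ltW alpha_gt0) _.
by apply: sumr_ge0 => x _; apply: mulr_ge0.
Qed.

Let avoid_ge0 S w : 0 <= avoid S w.
Proof. exact: ler0n. Qed.

Let avoidS (S S' : {set E}) w : S' \subset S -> avoid S w <= avoid S' w.
Proof.
move=> /subsetP sS; rewrite /avoid ler_nat; case: (boolP [forall e in S, _]) => // /forall_inP avS.
by rewrite lt0b; apply/forall_inP=> e /sS /avS.
Qed.

Let pavoidS (S S' : {set E}) : S' \subset S -> pavoid S <= pavoid S'.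
Proof. by move=> sS; apply: le_expect => // w; apply: avoidS. Qed.

Let pavoid_ge0 S : 0 <= pavoid S.
Proof. by apply: sumr_ge0 => w _; apply: mulr_ge0 (weight_ge0 mu_ge0 _) _. Qed.

Let avoid_depends (J : {set B}) (S : {set E}) :
  (forall e, e \in S -> [disjoint scope e & J]) -> depends_on (~: J) (avoid S).
Proof.
move=> SJ w w' ww'; rewrite /avoid; congr ((nat_of_bool _)%:R).
apply: eq_forallb => e; case: (boolP (e \in S)) => //= eS; congr (~~ _).
apply: A_scope => j je; apply: ww'; rewrite inE.
by rewrite (disjointFr (SJ _ eS) je).
Qed.

Let hit (S : {set E}) (J : {set B}) := [set e in S | ~~ [disjoint scope e & J]].

(** The coordinates of [J] are freed one at a time. Given that the remaining events are avoided, the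
    events dropped with one coordinate have total probability at most [tau] by [bound_sum], so each
    coordinate costs a factor [alpha = (1 - tau)^-1]. *)
Let pavoid_remove (S : {set E}) (J : {set B}) :
  (forall (S' : {set E}) e, S' \proper S ->
     expect mu (fun w => (A e w)%:R * avoid S' w) <= lll_bound e * pavoid S') ->
  pavoid (S :\: hit S J) <= alpha ^+ #|J| * pavoid S.
Proof.
move=> IH.
have [k Jk] := ubnP #|J|; elim: k J Jk => // k IHk J; rewrite ltnS => Jk.
have [->|[j jJ]] := set_0Vmem J.
  rewrite cards0 expr0 mul1r; apply: pavoidS; apply/subsetP=> e eS.
  by rewrite !inE eS disjoint_sym disjoints_subset sub0set.
set J' := J :\ j; set S1 := S :\: hit S J'; set S2 := S :\: hit S J.
have cJ : #|J| = #|J'|.+1 by rewrite (cardsD1 j J) jJ.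
have /IHk {IHk} IHJ : (#|J'| < k)%N by rewrite -cJ.
have sS2 : S2 \subset S1.
  apply/subsetP=> e; rewrite !inE => /andP[+ eS]; rewrite eS /= !andbT !negbK.
  move=> /disjointWr; apply; exact: subsetDl.
rewrite cJ exprSr -mulrA; apply: le_trans (_ : alpha * pavoid S1 <= _); last first.
  by rewrite mulrCA; apply: ler_wpM2l IHJ; apply: ltW.
have step : (1 - tau) * pavoid S2 <= pavoid S1.
  have : pavoid S2 - \sum_(e in S1 | j \in scope e) expect mu (fun w => (A e w)%:R * avoid S2 w)
           <= pavoid S1.
    rewrite -expect_sum -expectB; apply: le_expect => // w.
    rewrite -mulr_suml -[X in X - _]mul1r -mulrBl {1}/avoid.
    case: forall_inP => [av2|_]; last by rewrite mulr0 avoid_ge0.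
    rewrite mulr1 lerBlDl /avoid; case: forall_inP => [_|].
      by rewrite lerDr; apply: sumr_ge0 => e _; apply: ler0n.
    move=> nav; rewrite addr0.
    have /exists_inP[e eS1 Ae] : [exists e in S1, A e w].
      by case: (boolP [exists e in S1, A e w]) => // /exists_inPn nA; case: nav => e /nA.
    have eS2 : e \notin S2 by apply: contraL Ae => /av2.
    have je : j \in scope e.
      move: eS1 eS2; rewrite !inE => /andP[+ eS]; rewrite eS !andbT !negbK => dJ' /pred0Pn[b].
      rewrite !inE => /andP[be bJ]; have [<- //|bj] := eqVneq b j.
      by have := disjointFr dJ' be; rewrite !inE bj bJ.
    rewrite (bigD1 e) /=; last by rewrite eS1.
    by rewrite Ae lerDl; apply: sumr_ge0 => i _; apply: ler0n.
  apply: le_trans; rewrite mulrBl mul1r lerD2l lerN2.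
  apply: le_trans (_ : \sum_(e in S1 | j \in scope e) lll_bound e * pavoid S2 <= _).
    apply: ler_sum => e /andP[eS1 je]; apply: IH.
    apply/properP; split; first exact: subsetDl.
    exists e; first by move: eS1; rewrite inE => /andP[].
    rewrite !inE negb_and negbK; apply/orP; left; move: eS1; rewrite !inE => /andP[_ ->] /=.
    by apply/pred0Pn; exists j; rewrite /= je jJ.
  rewrite -mulr_suml; apply: ler_wpM2r; first exact: pavoid_ge0.
  apply: le_trans (bound_sum j); rewrite big_mkcondl; apply: ler_sum => e _.
  by case: ifP.
by rewrite -[leLHS]mul1r -alphaE -mulrA ler_pM2l.
Qed.

Lemma local_lemma : exists w : {ffun B -> X},
  (forall j, mu j (w j) != 0) /\ (forall e, ~~ A e w).
Proof.
have claim (S : {set E}) e :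
    expect mu (fun w => (A e w)%:R * avoid S w) <= lll_bound e * pavoid S.
  have [k Sk] := ubnP #|S|; elim: k S Sk e => // k IHk S; rewrite ltnS => Sk e.
  have IH (S' : {set E}) f : S' \proper S ->
      expect mu (fun w => (A f w)%:R * avoid S' w) <= lll_bound f * pavoid S'.
    by move=> /proper_card S'S; apply: IHk; apply: leq_trans S'S Sk.
  (* The certificate expands into one term per set [J] of coordinates where [h] is taken. Such a
     term depends on [J] only, so the events meeting [J] are dropped to gain independence. The
     resulting [alpha ^+ #|J|] is then shared out as one [alpha] per factor [h]. *)
  pose g (J : {set B}) (w : {ffun B -> X}) := \prod_j (if j \in J then h e j (w j) else u e j).
  have gJ (J : {set B}) : expect mu (fun w => g J w * avoid S w) <=
     (\prod_j (if j \in J then alpha * \sum_x mu j x * h e j x else u e j)) * pavoid S.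
    apply: le_trans (_ : expect mu (g J) * pavoid (S :\: hit S J) <= _).
      rewrite -(@expectM_indep _ _ _ _ _ J) //; last first.
      - by apply: avoid_depends => f; rewrite !inE => /andP[+ fS]; rewrite fS negbK.
      - move=> w w' ww'; apply: eq_bigr => j _.
        by case: (boolP (j \in J)) => // /ww' ->.
      apply: le_expect => // w; apply: ler_wpM2l; last exact/avoidS/subsetDl.
      by apply: prodr_ge0 => j _; case: ifP.
    have gE : expect mu (g J) =
        \prod_j (if j \in J then \sum_x mu j x * h e j x else u e j).
      rewrite (expect_prod mu (fun j x => if j \in J then h e j x else u e j)).
      apply: eq_bigr => j _; case: ifP => // _.
      by rewrite -mulr_suml mu_sum1 mul1r.
    have ge0 : 0 <= expect mu (g J).
      rewrite gE; apply: prodr_ge0 => j _; case: ifP => // _.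
      by apply: sumr_ge0 => x _; apply: mulr_ge0.
    apply: le_trans (ler_wpM2l ge0 (pavoid_remove J IH)) _.
    rewrite mulrA; apply: ler_wpM2r; first exact: pavoid_ge0.
    rewrite gE mulrC -prodr_const big_mkcond -big_split /=.
    by rewrite le_eqVlt; apply/orP; left; apply/eqP/eq_bigr => j _; case: ifP; rewrite ?mul1r.
  apply: le_trans (_ : expect mu (fun w => kap e * \sum_J g J w * avoid S w) <= _).
    apply: le_expect => // w; apply: le_trans (ler_wpM2r (avoid_ge0 S w) (A_cert e w)) _.
    rewrite -mulrA; apply: ler_wpM2l (kap_ge0 e) _ _ _.
    under eq_bigr do rewrite addrC.
    by rewrite bigA_distr -mulr_suml.
  rewrite expectZ -mulrA; apply: ler_wpM2l (kap_ge0 e) _ _ _.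
  rewrite expect_sum; under [X in _ <= X * _]eq_bigr do rewrite addrC.
  by rewrite bigA_distr mulr_suml; apply: ler_sum => J _; apply: gJ.
(* Each further event multiplies the probability of avoidance by at least [1 - tau]. *)
have avoid_pos : 0 < pavoid setT.
  have [k] := ubnP #|[set: E]|; elim: k [set: E] => // k IHk S; rewrite ltnS => Sk.
  have [->|[e eS]] := set_0Vmem S.
    rewrite /pavoid (@eq_expect _ _ _ mu _ (fun=> 1)) ?expect1 //.
    by move=> w; rewrite /avoid; case: forall_inP => // -[] e; rewrite inE.
  have cS : #|S| = #|S :\ e|.+1 by rewrite (cardsD1 e S) eS.
  have S'0 : 0 < pavoid (S :\ e) by apply: IHk; rewrite -cS.
  apply: lt_le_trans (_ : (1 - tau) * pavoid (S :\ e) <= _).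
    by rewrite mulr_gt0 // subr_gt0.
  apply: le_trans (_ : pavoid (S :\ e) - expect mu (fun w => (A e w)%:R * avoid (S :\ e) w) <= _).
    rewrite mulrBl mul1r lerD2l lerN2; apply: le_trans (claim _ _) _.
    by apply: ler_wpM2r => //; apply: ltW.
  rewrite -expectB; apply: le_expect => // w.
  rewrite -[X in X - _]mul1r -mulrBl /avoid.
  case: forall_inP => [av|_]; last by rewrite mulr0 ler0n.
  have [Ae|nAe] := boolP (A e w); first by rewrite subrr mul0r ler0n.
  case: forall_inP => [_|[]]; first by rewrite subr0 mulr1.
  move=> f fS; have [-> //|fe] := eqVneq f e.
  by apply: av; rewrite !inE fe.
have [w /andP[w0 aw]|no] := pickP (fun w => (weight mu w != 0) && (avoid setT w != 0)).
  exists w; split=> [j|e].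
    by apply: contraNneq w0 => w0; rewrite /weight (bigD1 j) //= w0 mul0r.
  move: aw; rewrite /avoid; case: forall_inP => [av _|_]; last by rewrite eqxx.
  by apply: av; rewrite inE.
move: avoid_pos; rewrite /pavoid /expect big1 ?ltxx // => w _.
by have /negbT := no w; rewrite negb_and !negbK => /orP[]/eqP->; rewrite ?mul0r ?mulr0.
Qed.
End LocalLemma.

(** * The local lemma with conflicts and sums of independent variables *)

(** For [z = theta * y], the bound [1 - z <= expR (- z)] gives [expR z <= (1 - z)^-1], which is at
    most [1 + z + 2 * z ^+ 2] when [z <= 2^-1]. Linearity in [y] allows expectations to be taken. *)
Lemma expR_sub1_le (R : realType) (theta y : R) :
  0 <= theta <= 2^-1 -> 0 <= y <= 1 ->
  expR (theta * y) - 1 <= (theta + 2 * theta ^+ 2) * y.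
Proof.
move=> /andP[th0 th1] /andP[y0 y1]; set z := theta * y.
have z0 : 0 <= z by apply: mulr_ge0.
have zth : z <= theta by rewrite ler_piMr.
have := expR_ge1Dx (- z); rewrite expRN => ez.
have e0 := expR_gt0 z.
have ez1 : expR z * (1 - z) <= 1 by rewrite mulrC -ler_pdivlMr // div1r.
apply: le_trans (_ : z + 2 * z * z <= _); last first.
  have zz : z * z <= theta * z by apply: ler_wpM2r.
  have -> : (theta + 2 * theta ^+ 2) * y = z + 2 * (theta * z) by rewrite /z; ring.
  by rewrite -mulrA lerD2l ler_pM2l.
rewrite lerBlDr -(ler_pM2r (_ : 0 < 1 - z)); last by lra.
apply: le_trans ez1 _; nra.
Qed.

Section ChernoffLocal.
Variables (R : realType) (B X E : finType) (mu : B -> X -> R) (c : rel (B * X)).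
Variables (Y : E -> B -> X -> R) (mean : E -> R) (M t tau Q : R).
Hypothesis mu_ge0 : forall j x, 0 <= mu j x.
Hypothesis mu_sum1 : forall j, \sum_x mu j x = 1.
Hypothesis c_sym : symmetric c.
Hypothesis c_blocks : forall a b, c a b -> a.1 != b.1.
Hypothesis Y_bounds : forall e j x, 0 <= Y e j x <= 1.
Hypothesis Y_mean : forall e, \sum_j \sum_x mu j x * Y e j x <= mean e.
Hypothesis meanM : forall e, mean e <= M.
Hypothesis M_gt0 : 0 < M.
Hypothesis t_bounds : 0 < t <= 4 * M.
Hypothesis tau_le : tau <= 2^-1.
Hypothesis Q_ge1 : 1 <= Q.
Hypothesis multiplicity :
  forall j, #|[set e | [exists x, Y e j x != 0]]|%:R <= Q.
Hypothesis conflict_le : forall a, \sum_(b | c a b) mu b.1 b.2 <= tau / 16.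
Hypothesis tail_le : 2 * Q * expR (- (t ^+ 2 / (16 * M))) <= tau.

(** This minimises the Chernoff exponent [4 * theta ^+ 2 * M - theta * t], whose value becomes
    [- (t ^+ 2 / (16 * M))]. *)
Let theta := t / (8 * M).
Let alpha := (1 - tau)^-1.
Let tail := expR (- (t ^+ 2 / (16 * M))).
Let E' := (((B * X) * (B * X)) + E)%type.
Let limit e := mean e + 2 * tau * M + t.

Let A (e : E') : pred {ffun B -> X} := fun w =>
  match e with
  | inl (a, b) => [&& c a b, w a.1 == a.2 & w b.1 == b.2]
  | inr e => ~~ (\sum_j Y e j (w j) <= limit e)
  end.

Let scope (e : E') : {set B} :=
  match e with
  | inl (a, b) => if c a b then [set a.1; b.1] else set0
  | inr e => [set j | [exists x, Y e j x != 0]]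
  end.

(** A conflict is certified by the product of its two indicators, and a large sum by its exponential
    moment, with factors written as [1 + (expR (theta * Y e j x) - 1)] so that only the increment is
    subject to conditioning. *)
Let kap (e : E') : R :=
  match e with
  | inl (a, b) => (c a b)%:R
  | inr e => expR (- (theta * limit e))
  end.

Let u (e : E') (j : B) : R :=
  match e with
  | inl (a, b) => ((j != a.1) && (j != b.1))%:R
  | inr _ => 1
  end.

Let h (e : E') (j : B) (x : X) : R :=
  match e with
  | inl (a, b) => if j == a.1 then (x == a.2)%:R
                  else if j == b.1 then (x == b.2)%:R else 0
  | inr e => expR (theta * Y e j x) - 1
  end.

Let tau_gt0 : 0 < tau.
Proof.
apply: lt_le_trans tail_le; rewrite mulr_gt0 ?expR_gt0 ?mulr_gt0 //.
exact: lt_le_trans Q_ge1.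
Qed.

Let theta_bounds : 0 <= theta <= 2^-1.
Proof.
have /andP[t0 t4] := t_bounds; have M8 : 0 < 8 * M by rewrite mulr_gt0.
apply/andP; split; first by rewrite /theta divr_ge0 // ltW.
by rewrite /theta ler_pdivrMr //; lra.
Qed.

Let alpha_bounds : 0 <= alpha <= 1 + 2 * tau.
Proof.
have t1 : 0 < 1 - tau by move: tau_le; lra.
apply/andP; split; first by rewrite /alpha invr_ge0 ltW.
by rewrite /alpha -div1r ler_pdivrMr //; move: tau_gt0 tau_le; nra.
Qed.

Let alpha2_le : alpha ^+ 2 <= 4.
Proof.
have /andP[al0 al1] := alpha_bounds.
rewrite (_ : 4 = 2 ^+ 2); last by rewrite -natrX.
by apply: lerXn2r; rewrite ?nnegrE //; move: tau_le; lra.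
Qed.

Let A_scope e : depends_on (scope e) (A e).
Proof.
case: e => [[a b]|e] w w' ww' /=.
  move: ww'; rewrite /A /scope; case: (c a b) => //= ww'.
  by rewrite !ww' ?inE ?eqxx ?orbT.
rewrite /A; congr (~~ (_ <= _)); apply: eq_bigr => j _.
have [/ww' -> //|] := boolP (j \in scope (inr e)).
by rewrite inE => /existsPn Y0; have /negPn/eqP-> := Y0 (w j); have /negPn/eqP-> := Y0 (w' j).
Qed.

Let A_cert e w : (A e w)%:R <= kap e * \prod_j (u e j + h e j (w j)).
Proof.
case: e => [[a b]|e].
  rewrite /A /kap; case: (boolP (c a b)) => cab /=; last by rewrite mul0r.
  have prod_ge0 : 0 <= \prod_j (u (inl (a, b)) j + h (inl (a, b)) j (w j)).
    apply: prodr_ge0 => j _; apply: addr_ge0; first exact: ler0n.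
    by rewrite /h; do 2?case: ifP => _.
  rewrite mul1r; case: eqP => [wa|]; case: eqP => [wb|] //=.
  rewrite big1 // => j _; rewrite /u /h.
  have [->|] := eqVneq j a.1; first by rewrite wa eqxx add0r.
  have [->|] := eqVneq j b.1; first by rewrite wb eqxx add0r.
  by rewrite addr0.
rewrite /kap /u /h; under eq_bigr do rewrite addrC subrK.
rewrite -expR_sum -mulr_sumr -expRD /A -ltNge.
case: ltP => [lt_lim|_]; last exact: expR_ge0.
rewrite -[leLHS]expR0 ler_expR addrC -mulrBr; apply: mulr_ge0.
  by case/andP: theta_bounds.
by rewrite subr_ge0 ltW.
Qed.

Let bound_conflict a b : c a b ->
  lll_bound mu kap u h alpha (inl (a, b)) = alpha ^+ 2 * (mu a.1 a.2 * mu b.1 b.2).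
Proof.
move=> cab; have ab := c_blocks cab; have ba : b.1 != a.1 by rewrite eq_sym.
have pick j x0 : \sum_x mu j x * (x == x0)%:R = mu j x0.
  by rewrite (bigD1 x0) //= eqxx mulr1 big1 ?addr0 // => x /negPf->; rewrite mulr0.
rewrite /lll_bound /kap cab mul1r (bigD1 a.1) //= (bigD1 b.1) //=.
rewrite [X in _ * (_ * X)]big1.
  rewrite !eqxx (negPf ba) /= !add0r !pick; ring.
move=> j /andP[/negPf ja /negPf jb]; rewrite ja jb /= big1 ?mulr0 ?addr0 //.
by move=> x _; rewrite mulr0.
Qed.

Let bound_linear e : lll_bound mu kap u h alpha (inr e) <= tail.
Proof.
have /andP[th0 th1] := theta_bounds; have /andP[al0 al1] := alpha_bounds.
have /andP[t0 t4] := t_bounds.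
pose y j := \sum_x mu j x * Y e j x.
have y_ge0 j : 0 <= y j.
  by apply: sumr_ge0 => x _; apply: mulr_ge0 => //; case/andP: (Y_bounds e j x).
rewrite /lll_bound /kap /u /h.
apply: le_trans (_ : expR (- (theta * limit e)) *
    \prod_j expR (alpha * ((theta + 2 * theta ^+ 2) * y j)) <= _).
  apply: ler_wpM2l; first exact: expR_ge0.
  apply: ler_prod => j _; apply/andP; split.
    apply: addr_ge0 => //; apply: mulr_ge0 => //; apply: sumr_ge0 => x _.
    apply: mulr_ge0 => //; rewrite subr_ge0 -[leLHS]expR0 ler_expR.
    by apply: mulr_ge0 => //; case/andP: (Y_bounds e j x).
  apply: le_trans (expR_ge1Dx _); rewrite lerD2l; apply: ler_wpM2l => //.
  rewrite mulr_sumr; apply: ler_sum => x _.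
  by rewrite mulrCA; apply: ler_wpM2l => //; apply: expR_sub1_le.
rewrite -expR_sum -expRD /tail ler_expR -!mulr_sumr.
have sm := Y_mean e; have mM := meanM e; set S := \sum_j y j.
have S0 : 0 <= S by apply: sumr_ge0.
have SM : S <= mean e by [].
(* Conditioning inflates the mean by [alpha <= 1 + 2 * tau], whence the term [2 * tau * M] of
   [limit]. The quadratic term only needs [alpha * S <= 2 * M]. *)
have step1 : alpha * ((theta + 2 * theta ^+ 2) * S) <=
             theta * (mean e + 2 * tau * M) + 4 * theta ^+ 2 * M.
  have th2 : 0 <= theta ^+ 2 by apply: sqr_ge0.
  have aS1 : alpha * S <= mean e + 2 * tau * M.
    apply: le_trans (ler_wpM2r S0 al1) _; rewrite mulrDl mul1r.
    by apply: lerD => //; rewrite -!mulrA ler_pM2l // ler_wpM2l ?(ltW tau_gt0) //; lra.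
  have aS2 : alpha * S <= 2 * M.
    apply: le_trans (ler_wpM2r S0 al1) _; apply: ler_pM => //; move: tau_gt0 tau_le; lra.
  have -> : alpha * ((theta + 2 * theta ^+ 2) * S) =
    theta * (alpha * S) + 2 * theta ^+ 2 * (alpha * S) by ring.
  apply: lerD; first exact: ler_wpM2l.
  have -> : 4 * theta ^+ 2 * M = 2 * theta ^+ 2 * (2 * M) by ring.
  by apply: ler_wpM2l => //; apply: mulr_ge0.
rewrite addrC lerBlDr; apply: le_trans step1 _; rewrite /limit.
have -> : theta * (mean e + 2 * tau * M + t) =
          theta * (mean e + 2 * tau * M) + theta * t by rewrite mulrDr.
rewrite addrCA lerD2l /theta.
have M0 := lt0r_neq0 M_gt0.
have -> : t / (8 * M) * t = t ^+ 2 / (8 * M) by rewrite mulrAC expr2.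
by rewrite le_eqVlt; apply/orP; left; apply/eqP; field.
Qed.

Let bound_sum j : \sum_(e | j \in scope e) lll_bound mu kap u h alpha e <= tau.
Proof.
have /andP[al0 al1] := alpha_bounds.
rewrite big_sumType /= (_ : tau = tau / 2 + tau / 2); last by field.
apply: lerD; last first.
  apply: le_trans (ler_sum _ (fun e _ => bound_linear e)) _.
  under eq_bigl do rewrite inE.
  rewrite sumr_const -[leLHS]mulr_natl.
  apply: le_trans (_ : Q * tail <= _); last by move: tail_le; rewrite -/tail; lra.
  apply: ler_wpM2r; first exact: expR_ge0.
  apply: le_trans (multiplicity j); rewrite ler_nat; apply/subset_leq_card/subsetP=> e.
  by rewrite inE unfold_in.
pose f (a b : B * X) := alpha ^+ 2 * (mu a.1 a.2 * mu b.1 b.2).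
have f_ge0 a b : 0 <= f a b by apply: mulr_ge0; [exact: sqr_ge0|exact: mulr_ge0].
have al2 := alpha2_le.
have half : \sum_x \sum_(b | c (j, x) b) f (j, x) b <= tau / 4.
  apply: le_trans (_ : \sum_x mu j x * (tau / 4) <= _).
    apply: ler_sum => x _; rewrite /f -mulr_sumr -mulr_sumr /= mulrCA.
    apply: ler_wpM2l => //; rewrite (_ : tau / 4 = 4 * (tau / 16)); last by field.
    by apply: ler_pM => //; [exact: sqr_ge0|apply: sumr_ge0 => b _; exact: mu_ge0].
  by rewrite -mulr_suml mu_sum1 mul1r.
(* Conflicts are ordered pairs, and [j] may be the block of either end. By symmetry of [c] both sums
   agree, and each is at most [tau / 4]. *)
apply: le_trans (_ : \sum_(a | a.1 == j) \sum_(b | c a b) f a b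
                     + \sum_(a | a.1 == j) \sum_(b | c a b) f a b <= _); last first.
  have -> : \sum_(a | a.1 == j) \sum_(b | c a b) f a b =
            \sum_x \sum_(b | c (j, x) b) f (j, x) b.
    rewrite (reindex (fun x => (j, x))) /=; last by exists snd => [//|[j' x]] /eqP <-.
    by apply: eq_bigl => x; rewrite eqxx.
  by apply: le_trans (lerD half half) _; lra.
rewrite [X in _ + X](_ : _ = \sum_(b | b.1 == j) \sum_(a | c a b) f a b); last first.
  by apply: eq_bigr => a _; apply: eq_big => [b|b _]; rewrite ?(c_sym a) //;
     rewrite /f mulrC [_ * mu a.1 _]mulrC mulrC.
rewrite [X in _ + X](exchange_big_dep predT) //= !pair_big_dep /=.
rewrite big_mkcond [X in _ <= X + _]big_mkcond [X in _ <= _ + X]big_mkcond -big_split.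
apply: ler_sum => -[a b] _ /=; rewrite /scope.
case: (boolP (c a b)) => cab; last by rewrite inE !andbF addr0.
rewrite !inE !andbT bound_conflict // -/(f a b) ![j == _]eq_sym.
have := f_ge0 a b.
case: (a.1 == j); case: (b.1 == j) => /= f0; rewrite ?addr0 ?add0r //.
by rewrite lerDr.
Qed.

Let bound_le e : lll_bound mu kap u h alpha e <= tau.
Proof.
have t0 := tau_gt0; have /andP[al0 al1] := alpha_bounds.
case: e => [[a b]|e]; last first.
  apply: le_trans (bound_linear e) _; apply: le_trans tail_le.
  rewrite -/tail ler_peMl ?expR_ge0 //; move: Q_ge1; lra.
have [cab|nc] := boolP (c a b); last by rewrite /lll_bound /kap (negPf nc) mul0r ltW.
have mb : mu b.1 b.2 <= tau / 16.
  apply: le_trans (conflict_le a); rewrite (bigD1 b) //= lerDl.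
  by apply: sumr_ge0 => i _.
have ma : mu a.1 a.2 <= 1.
  by rewrite -(mu_sum1 a.1) (bigD1 a.2) //= lerDl; apply: sumr_ge0 => i _.
rewrite bound_conflict //; apply: le_trans (_ : 4 * (1 * (tau / 16)) <= _); last by lra.
apply: ler_pM alpha2_le _; [exact: sqr_ge0|exact: mulr_ge0|exact: ler_pM].
Qed.

(** The excess over the mean has two sources: [2 * tau * M] is the price of conditioning, and [t] is
    the Chernoff deviation. *)
Lemma chernoff_local_lemma : exists w : B -> X,
  [/\ forall j, mu j (w j) != 0,
      forall j k, ~~ c (j, w j) (k, w k)
    & forall e, \sum_j Y e j (w j) <= mean e + 2 * tau * M + t].
Proof.
have t0 := tau_gt0; have /andP[th0 _] := theta_bounds.
have kap0 e : 0 <= kap e by case: e => [[a b]|e]; rewrite /kap ?ler0n ?expR_ge0.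
have u0 e j : 0 <= u e j by case: e => [[a b]|e]; rewrite /u ?ler0n.
have h0 e j x : 0 <= h e j x.
  case: e => [[a b]|e]; rewrite /h; first by do 2?case: ifP => _.
  rewrite subr_ge0 -[leLHS]expR0 ler_expR mulr_ge0 //.
  by case/andP: (Y_bounds e j x).
have tau1 : tau < 1 by move: tau_le; lra.
have aE : alpha * (1 - tau) = 1 by rewrite mulVf // subr_eq0 gt_eqF.
have [w [w0 wA]] := local_lemma mu_ge0 mu_sum1 A_scope kap0 u0 h0 A_cert
  tau1 aE bound_le bound_sum.
exists w; split=> // [j k|e]; last by have := wA (inr e); rewrite /A negbK.
by apply/negP=> cjk; have := wA (inl ((j, w j), (k, w k))); rewrite /A cjk /= !eqxx.
Qed.

End ChernoffLocal.

(** * Shrinking the blocks *)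

(** [expR (c * x)] is the power [k.+1] of [expR (r * x)], hence at least [(r * x) ^+ k.+1], which
    dominates [C * x ^+ k] once [x >= C / r ^+ k.+1]. *)
Lemma exp_beats_pow (R : realType) (C c : R) (k : nat) : 0 < c ->
  exists2 x0 : R, 1 <= x0 & forall x, x0 <= x -> C * x ^+ k * expR (- (c * x)) <= 1.
Proof.
move=> c0; set r := c / k.+1%:R.
have r0 : 0 < r by rewrite divr_gt0.
exists (Num.max 1 (C / r ^+ k.+1)) => [|x]; first by rewrite le_max lexx.
rewrite ge_max => /andP[x1 xC].
have x0 : 0 < x by apply: lt_le_trans x1.
rewrite expRN ler_pdivrMr ?expR_gt0 // mul1r.
apply: le_trans (_ : (r * x) ^+ k.+1 <= _).
  rewrite exprMn [x ^+ k.+1]exprS mulrA.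
  apply: ler_wpM2r; first by rewrite exprn_ge0 // ltW.
  by rewrite mulrC -ler_pdivrMr ?exprn_gt0.
have -> : c * x = k.+1%:R * (r * x) by rewrite mulrA [_%:R * r]mulrC divfK ?pnatr_eq0.
have rx0 : 0 <= r * x by apply: mulr_ge0; apply: ltW.
rewrite expRM_natl lerXn2r ?nnegrE ?expR_ge0 //.
by apply: le_trans (expR_ge1Dx _); rewrite lerDr.
Qed.

Lemma card_exists_le (S X : finType) (P : S -> X -> bool) :
  (#|[set v | [exists x, P v x]]| <= \sum_x #|[set v | P v x]|)%N.
Proof.
under eq_bigr do rewrite -sum1dep_card big_mkcond.
rewrite exchange_big -sum1dep_card big_mkcond; apply: leq_sum => v _.
case: ifP => // /existsP[x Pvx]; rewrite (bigD1 x) //= Pvx; exact: leq_addr.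
Qed.

(** * Graphs with blocks of equal size *)

Section BlockGraphs.
Variables (R : realType) (B F : finType).
Implicit Type e : rel (B * F).

Definition block_deg e (v : B * F) (j : B) : nat := #|[set x | e v (j, x)]|.

Definition block_graph e := symmetric e /\ forall i x y, ~~ e (i, x) (i, y).

Definition has_transversal e :=
  exists f : B -> F, forall i j, ~~ e (i, f i) (j, f j).

Definition bounded_graph e (D S l : R) :=
  [/\ forall v, (deg e v)%:R <= D,
      forall i, \sum_x (deg e (i, x))%:R <= S
    & forall v j, (block_deg e v j)%:R <= l].

Lemma degE e v : (deg e v)%:R = \sum_w (e v w)%:R :> R.
Proof.
rewrite /deg -sum1dep_card natr_sum big_mkcond; apply: eq_bigr => w _.
by case: (e v w).
Qed.

Lemma block_degE e v j : (block_deg e v j)%:R = \sum_x (e v (j, x))%:R :> R.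
Proof.
rewrite /block_deg -sum1dep_card natr_sum big_mkcond; apply: eq_bigr => w _.
by case: (e v (j, w)).
Qed.

Lemma deg_sum e v : (deg e v)%:R = \sum_j (block_deg e v j)%:R :> R.
Proof.
rewrite degE; under [RHS]eq_bigr do rewrite block_degE.
by rewrite pair_big /=; apply: eq_bigr => -[].
Qed.

Lemma block_deg_le e v j : (block_deg e v j <= deg e v)%N.
Proof.
rewrite /block_deg /deg -(card_imset _ (_ : injective (pair j))) => [|x y [] //].
by apply/subset_leq_card/subsetP=> _ /imsetP[x + ->]; rewrite !inE.
Qed.

Lemma card_touching e (D : R) j : symmetric e ->
  (forall v, (deg e v)%:R <= D) ->
  #|[set v | [exists x, e v (j, x)]]|%:R <= #|F|%:R * D.
Proof.
move=> es eD; apply: le_trans (_ : \sum_(x : F) (deg e (j, x))%:R <= _).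
  rewrite -natr_sum ler_nat; apply: leq_trans (card_exists_le _) _.
  by apply: leq_sum => x _; apply/subset_leq_card/subsetP=> v; rewrite !inE es.
by rewrite mulr_natl -sumr_const; apply: ler_sum.
Qed.
End BlockGraphs.

(** As [g] picks one member of each group of 8, [relpre (thin g) e] is the subgraph induced by the
    picked vertices, indexed by groups. *)
Definition thin (B F : Type) (g : B * F -> 'I_8) (v : B * F) : B * (F * 'I_8) :=
  (v.1, (v.2, g v)).

(** Here [x] stands for the cube root of the block size, up to a constant, so errors [2 * x ^+ 2]
    are relative errors of order [x^-1]. The second bound concerns the old degrees of picked
    vertices; the first one converts it to new degrees. *)
Lemma thinning_exists (R : realType) (K : R) : 1 <= K ->
  exists2 x0 : R, 1 <= x0 & forall x, x0 <= x ->
  forall (B F : finType) (e : rel (B * (F * 'I_8))), block_graph e ->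
  8 * #|F|%:R <= 8 * x ^+ 3 ->
  (forall v, (deg e v)%:R <= K * (8 * #|F|%:R)) ->
  exists g : B * F -> 'I_8,
  [/\ forall v, (deg (relpre (thin g) e) v)%:R <= (deg e (thin g v))%:R / 8 + 2 * x ^+ 2,
      forall i, \sum_y (deg e (thin g (i, y)))%:R <=
        (\sum_z (deg e (i, z))%:R) / 8 + K * (8 * #|F|%:R) * (2 * x ^+ 2)
    & forall v j, (block_deg (relpre (thin g) e) v j)%:R <=
        (block_deg e (thin g v) j)%:R / 8 + 2 * x ^+ 2].
Proof.
move=> K1; have K0 : 0 < K by apply: lt_le_trans K1.
have c0 : 0 < (16 * K)^-1 by rewrite invr_gt0 mulr_gt0.
have [x0 x01 x0P] := exp_beats_pow (516 * K ^+ 2) 4 c0.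
exists x0 => // x /[dup] /(le_trans x01) x1 /x0P {x0P x01 x0} expx B F e [es eb] nx eK.
have xp : 0 < x by apply: lt_le_trans x1.
set n : R := #|F|%:R in nx eK *; set n8 := 8 * n in nx eK *.
have n0 : 0 <= n by apply: ler0n.
have n80 : 0 <= n8 by apply: mulr_ge0.
have Kn0 : 0 <= K * n8 by rewrite mulr_ge0 // ltW.
(* The sums to control are the degree of every old vertex ([None]), its degree into each block
   ([Some j]), and the degree sum over the picked vertices of each block, scaled by [K * n8]. *)
pose E := (((B * (F * 'I_8)) * option B) + B)%type.
pose sel (o : option B) (j : B) := (o == None) || (o == Some j).
pose Y (ev : E) (a : B * F) (z : 'I_8) : R :=
  match ev with
  | inl (v, o) => (e v (a.1, (a.2, z)) && sel o a.1)%:R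
  | inr i => if a.1 == i then (deg e (i, (a.2, z)))%:R / (K * n8) else 0
  end.
pose mu (a : B * F) (z : 'I_8) : R := 8^-1.
pose mean ev := \sum_a \sum_z mu a z * Y ev a z.
have sumY ev : mean ev = (\sum_a \sum_z Y ev a z) / 8.
  rewrite mulr_suml; apply: eq_bigr => a _; rewrite mulr_suml; apply: eq_bigr => z _.
  by rewrite mulrC.
have sumY_deg v : \sum_a \sum_z Y (inl (v, None)) a z = (deg e v)%:R.
  rewrite degE !pair_big /= (reindex (fun w : B * (F * 'I_8) => ((w.1, w.2.1), w.2.2))) /=.
    by apply: eq_bigr => -[j [y z]] _; rewrite /Y /sel /= andbT.
  by exists (fun p => (p.1.1, (p.1.2, p.2))) => [[j [y z]]|[[j y] z]].
have sumY_block v j : \sum_a \sum_z Y (inl (v, Some j)) a z = (block_deg e v j)%:R.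
  rewrite block_degE !pair_big /= (bigID (fun p : B * F * 'I_8 => p.1.1 == j)) /=.
  rewrite [X in _ + X]big1 ?addr0 => [|[[i y] z] /= ij]; last first.
    by rewrite /Y /sel /= (inj_eq Some_inj) eq_sym (negPf ij) andbF.
  rewrite (reindex (fun w : F * 'I_8 => ((j, w.1), w.2))) /=.
    by apply: eq_big => [[y z]|[y z] _]; rewrite /= ?eqxx // /Y /sel /= eqxx andbT.
  by exists (fun p => (p.1.2, p.2)) => [[y z]|[[i y] z]] //=; rewrite inE /= => /eqP ->.
have sumY_total i : \sum_a \sum_z Y (inr i) a z = (\sum_z (deg e (i, z))%:R) / (K * n8).
  rewrite !pair_big /= (bigID (fun p : B * F * 'I_8 => p.1.1 == i)) /=.
  rewrite [X in _ + X]big1 ?addr0 => [|[[j y] z] /= /negPf ij]; last by rewrite /Y /= ij.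
  rewrite (reindex (fun w : F * 'I_8 => ((i, w.1), w.2))) /=.
    rewrite mulr_suml; apply: eq_big => [[y z]|[y z] _]; rewrite /= ?eqxx // /Y /=.
  by exists (fun p => (p.1.2, p.2)) => [[y z]|[[j y] z]] //=; rewrite inE /= => /eqP ->.
(* With [t = x ^+ 2], this gives [2 * tau * M = t] and a tail exponent linear in [x]. For [Q], a
   group is adjacent to at most [64 * K * x ^+ 3] vertices, each with two sums, and one more sum
   comes from its block. *)
pose M := K * x ^+ 3; pose tau := (2 * K * x)^-1; pose Q := 129 * K * x ^+ 3.
have KxM : K * n8 / 8 <= M by rewrite /M -mulrA ler_pM2l //; lra.
have Y01 ev a z : 0 <= Y ev a z <= 1.
  case: ev => [[v o]|i] /=; first by rewrite ler0n lern1 leq_b1.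
  case: ifP => _; last by rewrite lexx ler01.
  rewrite divr_ge0 //=; have [Kn|Kn] := ltP 0 (K * n8); first by rewrite ler_pdivrMr // mul1r.
  (* When [F] is empty the scale vanishes, and the quotient is 0 by convention. *)
  have -> : K * n8 = 0 by apply: le_anti; rewrite Kn Kn0.
  by rewrite invr0 mulr0 ler01.
have meanM ev : mean ev <= M.
  rewrite sumY; case: ev => [[v [j|]]|i]; rewrite ?sumY_deg ?sumY_block ?sumY_total.
  - apply: le_trans KxM; rewrite ler_pM2r ?invr_gt0 //; apply: le_trans (eK v).
    by rewrite ler_nat block_deg_le.
  - by apply: le_trans KxM; rewrite ler_pM2r ?invr_gt0.
  - apply: le_trans (_ : n8 / 8 <= _); last first.
      apply: le_trans (_ : x ^+ 3 <= _); first by lra.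
      by rewrite ler_peMl // exprn_ge0 // ltW.
    rewrite ler_pM2r ?invr_gt0 //.
    have [Kn|Kn] := ltP 0 (K * n8); last first.
      by have -> : K * n8 = 0; [apply: le_anti; rewrite Kn Kn0|rewrite invr0 mulr0].
    rewrite ler_pdivrMr //; apply: le_trans (ler_sum _ (fun z _ => eK (i, z))) _.
    by rewrite sumr_const card_prod card_ord -[leLHS]mulr_natl natrM /n8 [_ * 8]mulrC.
have M0 : 0 < M by rewrite mulr_gt0 // exprn_gt0.
have tB : 0 < x ^+ 2 <= 4 * M.
  rewrite exprn_gt0 //= /M exprS mulrA mulrA ler_peMl ?exprn_ge0 1?ltW //; nra.
have tau_le : tau <= 2^-1.
  rewrite /tau lef_pV2 ?posrE ?mulr_gt0 //; nra.
have Q1 : 1 <= Q.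
  have x31 : 1 <= x ^+ 3 by apply: exprn_ege1.
  by rewrite /Q -mulrA mulr_ege1 ?mulr_ege1 // (ler_nat _ 1).
have mu0 (a : B * F) (z : 'I_8) : 0 <= mu a z by rewrite invr_ge0.
have mu1 (a : B * F) : \sum_z mu a z = 1.
  by rewrite sumr_const card_ord -[LHS]mulr_natl mulfV // pnatr_eq0.
have mult a : #|[set ev | [exists z, Y ev a z != 0]]|%:R <= Q.
  case: a => j y; set N := [set v | [exists z, e v (j, (y, z))]].
  have NK : #|N|%:R <= 8 * (K * n8).
    apply: le_trans (_ : \sum_(z < 8) (deg e (j, (y, z)))%:R <= _).
      rewrite -natr_sum ler_nat; apply: leq_trans (card_exists_le _) _.
      by apply: leq_sum => z _; apply/subset_leq_card/subsetP=> v; rewrite !inE es.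
    apply: le_trans (ler_sum _ (fun z _ => eK (j, (y, z)))) _.
    by rewrite sumr_const card_ord -[leLHS]mulr_natl.
  have sub : [set ev | [exists z, Y ev (j, y) z != 0]] \subset
      inl @: setX N [set None; Some j] :|: [set inr j].
    apply/subsetP=> -[[v o]|i]; rewrite !inE => /existsP[z] /=.
      rewrite pnatr_eq0 eqb0 negbK => /andP[ez so]; rewrite orbF.
      rewrite mem_imset; last by move=> ? ? [].
      by rewrite !inE; apply/andP; split=> //; apply/existsP; exists z.
    by have [->|_] := eqVneq j i; rewrite !eqxx ?orbT.
  have := leq_trans (subset_leq_card sub) (leq_card_setU _ _).
  rewrite cards1 card_imset; last by move=> ? ? [].
  rewrite cardsX cards2 /= -(ler_nat R) natrD natrM => /le_trans; apply.
  have x31 : 1 <= x ^+ 3 by apply: exprn_ege1.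
  have Kx1 : 1 <= K * x ^+ 3 by rewrite mulr_ege1.
  have Kn8 : K * n8 <= K * (8 * x ^+ 3) by rewrite ler_pM2l.
  rewrite /Q; lra.
have cle (a : B * F * 'I_8) : \sum_(b : B * F * 'I_8 | false) mu b.1 b.2 <= tau / 16.
  by rewrite big_pred0 // divr_ge0 // invr_ge0 !mulr_ge0 // ltW.
have tail : 2 * Q * expR (- ((x ^+ 2) ^+ 2 / (16 * M))) <= tau.
  have Kx0 : 0 < 2 * K * x by rewrite !mulr_gt0.
  rewrite /tau -[leRHS]div1r ler_pdivlMr //.
  have -> : (x ^+ 2) ^+ 2 / (16 * M) = (16 * K)^-1 * x.
    by rewrite /M; field; rewrite ?lt0r_neq0.
  have -> : 2 * Q * expR (- ((16 * K)^-1 * x)) * (2 * K * x) =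
    516 * K ^+ 2 * x ^+ 4 * expR (- ((16 * K)^-1 * x)) by rewrite /Q; ring.
  by [].
pose c (a b : B * F * 'I_8) := false.
have cs : symmetric c by [].
have cb a b : c a b -> a.1 != b.1 by [].
have mean_le ev : \sum_a \sum_z mu a z * Y ev a z <= mean ev by [].
have [g [_ _ gY]] := chernoff_local_lemma mu0 mu1 cs cb
  Y01 mean_le meanM M0 tB tau_le Q1 mult cle tail.
exists g.
have err : 2 * tau * M + x ^+ 2 = 2 * x ^+ 2.
  by rewrite /tau /M; field; rewrite ?lt0r_neq0.
split.
- move=> v; rewrite -sumY_deg -sumY -err addrA; apply: le_trans (gY _).
  rewrite degE; apply: ler_sum => -[j y] _ /=; rewrite /Y /sel /= andbT.
  by rewrite es.
- move=> i; have := gY (inr i); rewrite -addrA err sumY sumY_total.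
  have [Kn|Kn] := ltP 0 (K * n8); last first.
    move=> _; have Kn00 : K * n8 = 0 by apply: le_anti; rewrite Kn Kn0.
    rewrite Kn00 mul0r addr0; apply: le_trans (_ : 0 <= _).
      by rewrite big1 // => y _; apply: le_anti; rewrite ler0n -Kn00 eK.
    by rewrite divr_ge0 // sumr_ge0.
  have -> : \sum_a Y (inr i) a (g a) = (\sum_y (deg e (thin g (i, y)))%:R) / (K * n8).
    rewrite (bigID (fun a : B * F => a.1 == i)) /=.
    rewrite [X in _ + X]big1 ?addr0 => [|[j y] /= /negPf ij]; last by rewrite ij.
    rewrite (reindex (pair i)) /=; last first.
      by exists snd => [y|[j y]] //=; rewrite inE /= => /eqP ->.
    by rewrite mulr_suml; apply: eq_big => [y|y _]; rewrite /= eqxx.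
  rewrite ler_pdivrMr // => /le_trans; apply.
  by rewrite le_eqVlt; apply/orP; left; apply/eqP;
     move: (lt0r_neq0 Kn); move: (K * n8) => k k0; field.
- move=> v j; rewrite -sumY_block -sumY -err addrA; apply: le_trans (gY _).
  rewrite block_degE; apply: le_trans
    (_ : \sum_(a : B * F | a.1 == j) Y (inl (thin g v, Some j)) a (g a) <= _).
    rewrite (reindex (pair j)) /=; last first.
      by exists snd => [y|[i y]] //=; rewrite inE /= => /eqP ->.
    rewrite [leRHS](eq_bigl predT) => [|y]; last by rewrite /= eqxx.
    by apply: ler_sum => y _; rewrite /Y /sel /= eqxx andbT.
  rewrite [leRHS](bigID (fun a : B * F => a.1 == j)) /= lerDl.
  by apply: sumr_ge0 => a _; case/andP: (Y01 (inl (thin g v, Some j)) a (g a)).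
Qed.

(** * Colouring class by class *)

(** Each block draws its class uniformly. Block degrees are at most [C * x ^+ 2] while the allowed
    error is of order [x ^+ 3], so the Chernoff exponent grows like [x]. *)
Lemma class_partition (R : realType) (m : nat) (K C delta : R) :
  (0 < m)%N -> 1 <= K -> 0 < C -> 0 < delta <= K ->
  exists2 x0 : R, 1 <= x0 & forall x, x0 <= x ->
  forall (B F : finType) (e : rel (B * F)), block_graph e ->
  x ^+ 3 <= #|F|%:R <= 8 * x ^+ 3 ->
  (forall v, (deg e v)%:R <= K * #|F|%:R) ->
  (forall v j, (block_deg e v j)%:R <= C * x ^+ 2) ->
  exists chi : B -> 'I_m, forall v c,
    \sum_(j | chi j == c) (block_deg e v j)%:R <= (deg e v)%:R / m%:R + delta * #|F|%:R.
Proof.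
move=> m0 K1 C0 /andP[d0 dK]; have K0 : 0 < K by apply: lt_le_trans K1.
have mR : 0 < m%:R :> R by rewrite ltr0n.
have m1 : 1 <= m%:R :> R by rewrite ler1n.
have c0 : 0 < delta ^+ 2 / (64 * K * C) by rewrite divr_gt0 ?exprn_gt0 // !mulr_gt0.
have [x0 x01 x0P] := exp_beats_pow (512 * K ^+ 2 * m%:R / delta) 6 c0.
exists x0 => // x /[dup] /(le_trans x01) x1 /x0P {x0P x01 x0} expx.
move=> B F e [es eb] /andP[nx nx8] eK eC.
have xp : 0 < x by apply: lt_le_trans x1.
set n : R := #|F|%:R in nx nx8 eK *.
have n0 : 0 < n by apply: lt_le_trans nx; apply: exprn_gt0.
set l := C * x ^+ 2 in eC *.
have l0 : 0 < l by rewrite mulr_gt0 // exprn_gt0.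
pose mu (j : B) (k : 'I_m) : R := m%:R^-1.
pose Y (ev : (B * F) * 'I_m) (j : B) (k : 'I_m) : R :=
  if k == ev.2 then (block_deg e ev.1 j)%:R / l else 0.
pose mean (ev : (B * F) * 'I_m) := (deg e ev.1)%:R / m%:R / l.
(* Both [t] and [2 * tau * M] are half of the allowed error [delta * n / l]. *)
pose M := K * n / l; pose t := delta * n / (2 * l); pose tau := delta / (4 * K).
pose Q := n * (K * n) * m%:R.
have M0 : 0 < M by rewrite divr_gt0 // mulr_gt0.
have t0 : 0 < t by rewrite divr_gt0 ?mulr_gt0.
have mu0 j k : 0 <= mu j k by rewrite invr_ge0.
have mu1 j : \sum_k mu j k = 1.
  by rewrite sumr_const card_ord -[LHS]mulr_natl mulfV // lt0r_neq0.
pose c (a b : B * 'I_m) := false.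
have cs : symmetric c by [].
have cb a b : c a b -> a.1 != b.1 by [].
have Y01 ev j k : 0 <= Y ev j k <= 1.
  rewrite /Y; case: ifP => _; last by rewrite lexx ler01.
  by rewrite divr_ge0 ?(ltW l0) //= ler_pdivrMr // mul1r eC.
have mean_le ev : \sum_j \sum_k mu j k * Y ev j k <= mean ev.
  rewrite /mean deg_sum !mulr_suml; apply: ler_sum => j _.
  rewrite (bigD1 ev.2) //= big1 => [|k /negPf ke]; last by rewrite /Y ke mulr0.
  by rewrite addr0 /Y eqxx /mu mulrA [_^-1 * _]mulrC.
have meanM ev : mean ev <= M.
  rewrite /mean /M ler_pM2r ?invr_gt0 // ler_pdivrMr //.
  by apply: le_trans (eK _) _; rewrite ler_peMr // mulr_ge0 // ltW.
have tM : t = delta / (2 * K) * M.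
  by rewrite /t /M; field; rewrite !lt0r_neq0.
have tB : 0 < t <= 4 * M.
  rewrite t0 tM ler_pM2r //= ler_pdivrMr ?mulr_gt0 //; lra.
have tau_le : tau <= 2^-1.
  rewrite /tau ler_pdivrMr ?mulr_gt0 //; lra.
have x31 : 1 <= x ^+ 3 by apply: exprn_ege1.
have n1 : 1 <= n by apply: le_trans nx.
have Q1 : 1 <= Q by rewrite !mulr_ege1.
have mult j : #|[set ev | [exists k, Y ev j k != 0]]|%:R <= Q.
  have sub : [set ev | [exists k, Y ev j k != 0]] \subset
     setX [set v | [exists y, e v (j, y)]] [set: 'I_m].
    apply/subsetP=> -[v k]; rewrite !inE andbT => /existsP[k']; rewrite /Y /=.
    case: ifP => _; last by rewrite eqxx.
    rewrite mulf_eq0 negb_or pnatr_eq0 => /andP[+ _].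
    rewrite cards_eq0 => /set0Pn[y]; rewrite inE => evy.
    by apply/existsP; exists y.
  apply: le_trans (_ : (#|[set v | [exists y, e v (j, y)]]| * m)%:R <= _).
    rewrite ler_nat; apply: leq_trans (subset_leq_card sub) _.
    by rewrite cardsX cardsT card_ord.
  by rewrite natrM /Q ler_pM2r //; apply: card_touching.
have cle (a : B * 'I_m) : \sum_(b : B * 'I_m | false) mu b.1 b.2 <= tau / 16.
  by rewrite big_pred0 // !divr_ge0 // ?(ltW d0) // mulr_ge0 // ltW.
have tail : 2 * Q * expR (- (t ^+ 2 / (16 * M))) <= tau.
  apply: le_trans (_ : 128 * K * m%:R * x ^+ 6 * expR (- (delta ^+ 2 / (64 * K * C) * x)) <= _).
    apply: ler_pM; [by rewrite !mulr_ge0 // ltW|exact: expR_ge0| |].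
      have nn : n * n <= (8 * x ^+ 3) * (8 * x ^+ 3) by apply: ler_pM => //; apply: ltW.
      have -> : 2 * Q = n * n * (2 * K * m%:R) by rewrite /Q; ring.
      have -> : 128 * K * m%:R * x ^+ 6 = (8 * x ^+ 3) * (8 * x ^+ 3) * (2 * K * m%:R) by ring.
      by apply: ler_wpM2r => //; rewrite !mulr_ge0 // ltW.
    rewrite ler_expR lerN2.
    have -> : t ^+ 2 / (16 * M) = delta ^+ 2 / (64 * K * C) * (n / x ^+ 2).
      by rewrite /t /M /l; field; rewrite !lt0r_neq0.
    rewrite ler_pM2l // ler_pdivlMr ?exprn_gt0 //.
  rewrite /tau ler_pdivlMr ?mulr_gt0 //.
  move: expx; set ex := expR _ => expx.
  have -> : 128 * K * m%:R * x ^+ 6 * ex * (4 * K) =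
     (512 * K ^+ 2 * m%:R / delta * x ^+ 6 * ex) * delta.
    by field; apply: lt0r_neq0.
  by rewrite -[leRHS]mul1r ler_pM2r.
have [chi [_ _ chiY]] := chernoff_local_lemma mu0 mu1 cs cb
  Y01 mean_le meanM M0 tB tau_le Q1 mult cle tail.
exists chi => v k; have := chiY (v, k); rewrite -addrA.
have -> : 2 * tau * M + t = delta * n / l.
  by rewrite tM /tau /M; field; rewrite !lt0r_neq0.
rewrite /mean /= -mulrDl ler_pdivlMr // => bound; apply: le_trans bound.
rewrite big_mkcond mulr_suml; apply: ler_sum => j _; rewrite /Y /=.
case: ifP => _; last by rewrite mul0r.
by rewrite divfK // lt0r_neq0.
Qed.

(* The left-hand side is the tangent at [y = a] to the right-hand side, which is
   convex in [y]. *)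
Lemma prod_tangent (R : realFieldType) (lam : nat -> R) (a y : R) (t : nat) :
  (forall c, (c < t)%N -> 0 <= lam c) ->
  (forall c, (c < t)%N -> lam c * a < 1) ->
  (forall c, (c < t)%N -> lam c * y <= 1) ->
  (\prod_(0 <= c < t) (1 - lam c * a)) *
    (1 - (\sum_(0 <= c < t) lam c / (1 - lam c * a)) * (y - a))
  <= \prod_(0 <= c < t) (1 - lam c * y).
Proof.
elim: t => [|t IH] l0 la ly; first by rewrite !big_geq // mul0r subr0 mul1r.
have {IH} IHt : _ := IH (fun c ct => l0 c (leqW ct)) (fun c ct => la c (leqW ct))
  (fun c ct => ly c (leqW ct)).
rewrite !big_nat_recr //=.
have := l0 t (ltnSn t); have := la t (ltnSn t); have := ly t (ltnSn t).
move: IHt.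
have P0 : 0 <= \prod_(0 <= c < t) (1 - lam c * a).
  rewrite big_nat_cond; apply: prodr_ge0 => c; rewrite andbT => /andP[_ ct].
  by rewrite subr_ge0 ltW // la // leqW.
have s0 : 0 <= \sum_(0 <= c < t) lam c / (1 - lam c * a).
  rewrite big_nat_cond; apply: sumr_ge0 => c; rewrite andbT => /andP[_ ct].
  by rewrite divr_ge0 ?l0 ?leqW // subr_ge0 ltW // la // leqW.
move: P0 s0; set P := \prod_(_ <= _ < _) _; set s := \sum_(_ <= _ < _) _.
set P' := \prod_(_ <= _ < _) _.
move: (lam t) => r P0 s0 IHt ry ra r0.
have ra0 : 0 < 1 - r * a by rewrite subr_gt0.
apply: le_trans (_ : P * (1 - s * (y - a)) * (1 - r * y) <= _); last first.
  by apply: ler_wpM2r; rewrite // subr_ge0.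
set q := r / (1 - r * a); have q0 : 0 <= q by rewrite divr_ge0 // ltW.
have -> : 1 - r * y = (1 - r * a) * (1 - q * (y - a)).
  by rewrite /q; field; apply: lt0r_neq0.
(* The product of two tangents of nonpositive slope is the tangent of the product plus a nonnegative
   quadratic term. *)
have -> : P * (1 - s * (y - a)) * ((1 - r * a) * (1 - q * (y - a))) =
   P * (1 - r * a) * (1 - (s + q) * (y - a)) + P * (1 - r * a) * (s * q * (y - a) ^+ 2) by ring.
rewrite lerDl; apply: mulr_ge0; first by apply: mulr_ge0 => //; apply: ltW.
by apply: mulr_ge0; [exact: mulr_ge0|exact: sqr_ge0].
Qed.

Section ClassColouring.
Variables (R : realType) (B F : finType) (e : rel (B * F)).
Variables (m : nat) (chi : B -> 'I_m) (D : B * F -> R) (K a eta l : R).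
Let n : R := #|F|%:R.
Let beta := 1 - a.

(* [nu c] bounds from below the fraction of each block that survives the first [c]
   classes, and [lam c * D v] from above the probability that [v] is lost to
   class [c]; the slack [eta] pays for the concentration errors. *)
Definition nu (c : nat) : R := 1 - a * c%:R / m%:R.
Definition lam (c : nat) : R := (m%:R * nu c)^-1.
Definition survival (c t : nat) (y : R) : R := \prod_(c <= k < t) (1 - lam k * y).

Definition alive (f : B -> F) (c : nat) (v : B * F) : bool :=
  [forall j, (chi j < c)%N ==> ~~ e v (j, f j)].

(* The sum bounds from below the expected number of vertices of block [i] that
   will remain after [t] classes, given the choices [f] made for the first [c]. *)
Definition coloured (f : B -> F) (c : nat) : Prop :=
  (forall j k, (chi j < c)%N -> (chi k < c)%N -> ~~ e (j, f j) (k, f k)) /\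
  (forall i t, (c <= t <= m)%N ->
     n * nu t <= \sum_(x | alive f c (i, x)) survival c t (D (i, x) + eta)).

(** A vertex expects at most [K / (m%:R * beta)] chosen neighbours in one class; the 16 is that of
    the conflict condition in [chernoff_local_lemma]. *)
Let tau := 16 * K / (m%:R * beta).
Let M := n / (m%:R * beta * l).

Hypothesis e_block : block_graph e.
Hypothesis n_gt0 : 0 < n.
Hypothesis m_gt0 : (0 < m)%N.
Hypothesis K_ge1 : 1 <= K.
Hypothesis a_bounds : 0 < a < 1.
Hypothesis eta_gt0 : 0 < eta.
Hypothesis l_gt0 : 0 < l.
Hypothesis D_ge0 : forall v, 0 <= D v.
Hypothesis D_le : forall v, D v + eta <= K.
Hypothesis D_sum : forall i, \sum_x (D (i, x) + eta) <= a * n.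
Hypothesis class_deg :
  forall v (c : 'I_m), \sum_(j | chi j == c) (block_deg e v j)%:R <= D v * n / m%:R.
Hypothesis deg_le : forall v, (deg e v)%:R <= K * n.
Hypothesis local_le : forall v j, (block_deg e v j)%:R <= l.
Hypothesis m_large : 64 * K <= m%:R * (eta * beta ^+ 3).
Hypothesis eta_le1 : eta <= 1.
Hypothesis tail_small :
  2 * (n * (K * n) * m.+1%:R) * expR (- (tau ^+ 2 * M / 4)) <= tau.

Let mR : 0 < m%:R :> R. Proof. by rewrite ltr0n. Qed.
Let beta_bounds : 0 < beta < 1.
Proof. by rewrite /beta; move: a_bounds; lra. Qed.

Let nu_ge c : (c <= m)%N -> beta <= nu c.
Proof.
have /andP[a0 a1] := a_bounds.
move=> cm; rewrite /nu /beta lerD2l lerN2 -mulrA ger_pMr // ler_pdivrMr // mul1r.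
by rewrite ler_nat.
Qed.

Let nu_gt0 c : (c <= m)%N -> 0 < nu c.
Proof. by move=> /nu_ge; apply: lt_le_trans; case/andP: beta_bounds. Qed.

Let nu_le1 c : nu c <= 1.
Proof.
have /andP[a0 a1] := a_bounds.
by rewrite /nu gerBl divr_ge0 ?ler0n // mulr_ge0 // ltW.
Qed.

Let lam_gt0 c : (c <= m)%N -> 0 < lam c.
Proof. by move=> cm; rewrite invr_gt0 mulr_gt0 // nu_gt0. Qed.

Let lam_le c : (c <= m)%N -> lam c <= (m%:R * beta)^-1.
Proof.
have /andP[b0 b1] := beta_bounds.
by move=> cm; rewrite lef_pV2 ?posrE ?mulr_gt0 ?nu_gt0 // ler_pM2l // nu_ge.
Qed.

Let lam_ge c : (c <= m)%N -> m%:R^-1 <= lam c.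
Proof.
by move=> cm; rewrite lef_pV2 ?posrE ?mulr_gt0 ?nu_gt0 // ger_pMr // nu_le1.
Qed.

Let Kmb : 64 * K <= m%:R * beta.
Proof.
have /andP[b0 b1] := beta_bounds.
apply: le_trans m_large _; rewrite ler_pM2l //.
apply: le_trans (_ : beta ^+ 3 <= _).
  by rewrite ger_pMl ?exprn_gt0.
by rewrite exprS ger_pMr // exprn_ile1 // ltW.
Qed.

Let lamD_le1 c v : (c <= m)%N -> lam c * (D v + eta) <= 1.
Proof.
have /andP[b0 b1] := beta_bounds.
move=> cm; apply: le_trans (_ : (m%:R * beta)^-1 * K <= _).
  apply: ler_pM => //; [by rewrite ltW // lam_gt0|by rewrite addr_ge0 // ltW|exact: lam_le].
rewrite mulrC ler_pdivrMr ?mulr_gt0 // mul1r; apply: le_trans Kmb.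
by rewrite ler_peMl //; move: K_ge1; lra.
Qed.

Let survival_ge0 c t v : (t <= m)%N -> 0 <= survival c t (D v + eta).
Proof.
move=> tm; rewrite /survival big_nat_cond; apply: prodr_ge0 => k.
rewrite andbT => /andP[_ kt]; rewrite subr_ge0 lamD_le1 //.
by apply: ltnW; apply: leq_trans tm.
Qed.

Let survival_le1 c t v : (t <= m)%N -> survival c t (D v + eta) <= 1.
Proof.
move=> tm; rewrite /survival big_nat_cond; apply: prodr_ile1 => k.
rewrite andbT => /andP[_ kt]; have km : (k <= m)%N by apply: ltnW; apply: leq_trans tm.
rewrite subr_ge0 lamD_le1 //= gerBl mulr_ge0 ?addr_ge0 // ltW //.
exact: lam_gt0.
Qed.

Let survivalS c t y : (c < t)%N ->
  survival c t y = (1 - lam c * y) * survival c.+1 t y.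
Proof. by move=> ct; rewrite /survival big_ltn. Qed.

(** The product telescopes, as [1 - lam c * a = nu c.+1 / nu c]. *)
Lemma nu_prod t : (t <= m)%N -> \prod_(0 <= c < t) (1 - lam c * a) = nu t.
Proof.
elim: t => [|t IH] tm; first by rewrite big_geq // /nu mulr0 mul0r subr0.
rewrite big_nat_recr //= IH; last exact: ltnW.
have n0 := nu_gt0 (ltnW tm).
have -> : nu t * (1 - lam t * a) = nu t - a / m%:R.
  by rewrite /lam; move: n0 mR; move: (nu t) (m%:R : R) => y z y0 z0; field; rewrite !lt0r_neq0.
rewrite /nu -natr1; move: mR; move: (m%:R : R) => z z0; field; exact: lt0r_neq0.
Qed.

(** Convexity makes a bound on the average of [D] sufficient: the survival product lies above its
    tangent at [a], whose linear term has a nonnegative sum by [D_sum]. *)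
Lemma coloured0 f : coloured f 0.
Proof.
have /andP[a0 a1] := a_bounds.
split=> [j k|i t /andP[_ tm]]; first by rewrite ltn0.
rewrite [leRHS](eq_bigl predT) => [|x]; last by apply/forallP=> j; rewrite ltn0.
have tM c : (c < t)%N -> (c <= m)%N by move=> ct; apply: ltnW; apply: leq_trans tm.
have l0 c : (c < t)%N -> 0 <= lam c by move=> /tM /lam_gt0 /ltW.
have la c : (c < t)%N -> lam c * a < 1.
  move=> /tM cm; apply: le_lt_trans (ler_wpM2r (ltW a0) (lam_le cm)) _.
  have /andP[b0 b1] := beta_bounds.
  rewrite mulrC ltr_pdivrMr ?mulr_gt0 // mul1r.
  by apply: lt_le_trans Kmb; move: K_ge1; lra.
set s := \sum_(0 <= c < t) lam c / (1 - lam c * a).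
have s0 : 0 <= s.
  rewrite /s big_nat_cond; apply: sumr_ge0 => c; rewrite andbT => /andP[_ ct].
  by rewrite divr_ge0 ?l0 // subr_ge0 ltW // la.
apply: le_trans (_ : \sum_x nu t * (1 - s * (D (i, x) + eta - a)) <= _); last first.
  apply: ler_sum => x _; rewrite -nu_prod //; apply: prod_tangent => // c /tM cm.
  exact: lamD_le1.
rewrite -mulr_sumr mulrC ler_pM2l ?nu_gt0 //.
rewrite sumrB -mulr_sumr sumrB !sumr_const -[1 *+ _]/(#|F|%:R) -/n lerDl oppr_ge0.
rewrite mulr_ge0_le0 // subr_le0 -mulr_natr -/n; exact: D_sum.
Qed.

(** Every block draws uniformly from its alive vertices, and the draws of class [c] are kept. The
    expected number of drawn neighbours of [v] is at most [lam c * D v], the loss provided for in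
    [survival]; deviations are covered by [eta]. *)
Lemma colour_step c f : (c < m)%N -> coloured f c -> exists f', coloured f' c.+1.
Proof.
move=> cm [f_proper f_lists].
have /andP[a0 a1] := a_bounds; have /andP[b0 b1] := beta_bounds.
have [es eb] := e_block.
pose c0 : 'I_m := Ordinal cm.
have cm' := ltnW cm; have nuc0 := nu_gt0 cm'; have lamc0 := lam_gt0 cm'.
have mb0 : 0 < m%:R * beta by rewrite mulr_gt0.
have K0 : 0 < K by apply: lt_le_trans K_ge1.
pose N j : R := \sum_(x | alive f c (j, x)) 1.
(* For [t = c] the survival product is empty, and the invariant counts alive vertices. *)
have N_ge j : n * nu c <= N j.
  apply: le_trans (f_lists j c _) _; first by rewrite leqnn.
  by apply: ler_sum => x _; rewrite /survival big_geq.
have N_gt0 j : 0 < N j by apply: lt_le_trans (N_ge j); rewrite mulr_gt0.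
pose mu j x : R := if alive f c (j, x) then (N j)^-1 else 0.
have mu0 j x : 0 <= mu j x by rewrite /mu; case: ifP => // _; rewrite invr_ge0 ltW.
have mu1 j : \sum_x mu j x = 1.
  rewrite /mu -big_mkcond -[RHS](mulfV (lt0r_neq0 (N_gt0 j))) {2}/N mulr_suml.
  by apply: eq_bigr => x _; rewrite mul1r.
have mu_le j x : mu j x <= (n * nu c)^-1.
  rewrite /mu; case: ifP => _; last by rewrite invr_ge0 mulr_ge0 // ltW.
  by rewrite lef_pV2 ?posrE ?mulr_gt0.
have hit_le v : \sum_(j | chi j == c0) \sum_y mu j y * (e v (j, y))%:R <= lam c * D v.
  apply: le_trans (_ : (n * nu c)^-1 * \sum_(j | chi j == c0) (block_deg e v j)%:R <= _).
    rewrite mulr_sumr; apply: ler_sum => j _; rewrite block_degE mulr_sumr.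
    by apply: ler_sum => y _; apply: ler_wpM2r.
  apply: le_trans (ler_wpM2l _ (class_deg v c0)) _.
    by rewrite invr_ge0 mulr_ge0 // ltW.
  rewrite /lam le_eqVlt; apply/orP; left; apply/eqP.
  by move: n_gt0 mR nuc0; move: n (m%:R : R) (nu c) => n' m' y *; field; rewrite !lt0r_neq0.
pose q (p r : B * F) := [&& chi p.1 == c0, chi r.1 == c0 & e p r].
have qs : symmetric q by move=> p r; rewrite /q es andbCA.
have qb p r : q p r -> p.1 != r.1.
  case/and3P=> _ _; apply: contraTneq; case: p r => [i x] [j y] /= ->; exact: eb.
have cle p : \sum_(r | q p r) mu r.1 r.2 <= tau / 16.
  apply: le_trans (_ : lam c * D p <= _); last first.
    rewrite (_ : tau / 16 = (m%:R * beta)^-1 * K); last first.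
      by rewrite /tau; field; rewrite !lt0r_neq0.
    apply: ler_pM => //; [exact: ltW|exact: lam_le|].
    by apply: le_trans (D_le p); rewrite lerDl ltW.
  apply: le_trans (hit_le p); rewrite pair_big_dep /= big_mkcond [leRHS]big_mkcond.
  apply: ler_sum => -[j y] _; rewrite /q /= andbT.
  case: (chi p.1 == c0); case: (chi j == c0) => //=; case: (e _ _); rewrite ?mulr1 ?mulr0 //.
pose phi (t : nat) v := survival c.+1 t (D v + eta).
(* For a block and a later time, this is the loss caused in that block when block [j] draws [y],
   weighted by survival up to that time and divided by the local degree bound [l] to lie in the unit
   interval. *)
pose Y (ev : B * 'I_m.+1) (j : B) (y : F) : R :=
  if (chi j == c0) && (c < ev.2)%N then
    (\sum_(x | alive f c (ev.1, x)) phi ev.2 (ev.1, x) * (e (ev.1, x) (j, y))%:R) / l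
  else 0.
pose mean (ev : B * 'I_m.+1) : R :=
  if (c < ev.2)%N then
    lam c * (\sum_(x | alive f c (ev.1, x)) phi ev.2 (ev.1, x) * D (ev.1, x)) / l
  else 0.
have phi0 (t : 'I_m.+1) v : 0 <= phi t v by apply: survival_ge0; rewrite -ltnS.
have phi1 (t : 'I_m.+1) v : phi t v <= 1 by apply: survival_le1; rewrite -ltnS.
have Y01 ev j y : 0 <= Y ev j y <= 1.
  rewrite /Y; case: ifP => _; last by rewrite lexx ler01.
  rewrite divr_ge0 ?(ltW l_gt0) ?sumr_ge0 //=; last by move=> x _; rewrite mulr_ge0.
  rewrite ler_pdivrMr // mul1r; apply: le_trans (local_le (j, y) ev.1).
  rewrite block_degE big_mkcond; apply: ler_sum => x _.
  by case: ifP => _; rewrite ?ler0n // es ler_piMl.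
have mean_le ev : \sum_j \sum_y mu j y * Y ev j y <= mean ev.
  case: ev => i t; rewrite /mean /Y /=; case: ltnP => ct; last first.
    by rewrite big1 // => j _; rewrite big1 // => y _; rewrite andbF mulr0.
  apply: le_trans (_ : (\sum_(x | alive f c (i, x)) phi t (i, x) *
     (\sum_(j | chi j == c0) \sum_y mu j y * (e (i, x) (j, y))%:R)) / l <= _); last first.
    rewrite ler_pM2r ?invr_gt0 // mulr_sumr; apply: ler_sum => x _.
    by rewrite mulrCA; apply: ler_wpM2l.
  under [in leRHS]eq_bigr do rewrite mulr_sumr.
  rewrite [in leRHS]exchange_big /= mulr_suml [leRHS]big_mkcond; apply: ler_sum => j _.
  rewrite andbT; case: ifP => _; last by rewrite big1 // => y _; rewrite mulr0.
  under [in leRHS]eq_bigr do rewrite mulr_sumr.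
  rewrite [in leRHS]exchange_big /= mulr_suml; apply: ler_sum => y _.
  rewrite mulrA; rewrite mulr_sumr ler_pM2r ?invr_gt0 //.
  by apply: ler_sum => x _; rewrite mulrCA.
have M0 : 0 < M by rewrite /M divr_gt0 // mulr_gt0.
have meanM ev : mean ev <= M.
  rewrite /mean; case: ifP => [ct|_]; last exact: ltW.
  rewrite /M invfM [n * _]mulrA ler_pM2r ?invr_gt0 // [n * _]mulrC.
  apply: ler_pM; [exact: ltW| |exact: lam_le|].
    by apply: sumr_ge0 => x _; apply: mulr_ge0.
  apply: le_trans (_ : \sum_x (D (ev.1, x) + eta) <= _); last first.
    by apply: le_trans (D_sum _) _; rewrite ger_pMl // ltW.
  rewrite big_mkcond; apply: ler_sum => x _.
  have De : D (ev.1, x) <= D (ev.1, x) + eta by rewrite lerDl ltW.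
  by case: ifP => _; rewrite (le_trans _ De) // ler_piMl.
have tau0 : 0 < tau by rewrite /tau divr_gt0 // mulr_gt0.
have tau_le : tau <= 2^-1.
  rewrite /tau ler_pdivrMr //; move: Kmb; lra.
have tB : 0 < 2 * tau * M <= 4 * M.
  apply/andP; split; first by apply: mulr_gt0 => //; apply: mulr_gt0.
  by rewrite ler_pM2r //; lra.
pose Q := n * (K * n) * m.+1%:R.
have Q1 : 1 <= Q.
  have n1 : 1 <= n by rewrite /n (ler_nat _ 1) -(ltr_nat R).
  by rewrite /Q !mulr_ege1 // ?ler1n //; exact: K_ge1.
have mult j : #|[set ev | [exists y, Y ev j y != 0]]|%:R <= Q.
  have sub : [set ev | [exists y, Y ev j y != 0]] \subset
     setX (fst @: [set v | [exists y, e v (j, y)]]) [set: 'I_m.+1].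
    apply/subsetP=> -[i t]; rewrite !inE andbT => /existsP[y].
    apply: contraNT => ni; rewrite /Y /= big1 ?mul0r ?if_same // => x _.
    case: (boolP (e _ _)) => exy; last by rewrite mulr0.
    case/negP: ni; apply/imsetP; exists (i, x) => //.
    by rewrite inE; apply/existsP; exists y.
  apply: le_trans (_ : (#|[set v | [exists y, e v (j, y)]]| * m.+1)%:R <= _).
    rewrite ler_nat; apply: leq_trans (subset_leq_card sub) _.
    by rewrite cardsX cardsT card_ord leq_mul2r leq_imset_card orbT.
  by rewrite natrM /Q ler_pM2r //; apply: card_touching.
have tail : 2 * Q * expR (- ((2 * tau * M) ^+ 2 / (16 * M))) <= tau.
  rewrite (_ : (2 * tau * M) ^+ 2 / (16 * M) = tau ^+ 2 * M / 4) //.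
  by move: M0; move: M => M' M0; field; apply: lt0r_neq0.
have [w [w_alive w_proper wY]] := chernoff_local_lemma mu0 mu1 qs qb
  Y01 mean_le meanM M0 tB tau_le Q1 mult cle tail.
have {}w_alive j : alive f c (j, w j).
  by have := w_alive j; rewrite /mu; case: ifP => //; rewrite eqxx.
pose f' j := if chi j == c0 then w j else f j.
have ltcS (j : B) : (chi j < c.+1)%N = (chi j < c)%N || (chi j == c0).
  by rewrite ltnS leq_eqVlt orbC -val_eqE.
have f'E j : (chi j < c)%N -> f' j = f j.
  by move=> jc; rewrite /f' -val_eqE /= (ltn_eqF jc).
have aliveE v : alive f' c.+1 v =
    alive f c v && [forall j, (chi j == c0) ==> ~~ e v (j, w j)].
  apply/forallP/andP => [H|[/forallP H1 /forallP H2] j].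
    split; apply/forallP=> j; apply/implyP=> jc; have := H j; rewrite ltcS jc ?orbT /=.
      by rewrite f'E.
    by rewrite /f' jc.
  apply/implyP; rewrite ltcS => /orP[jc|jc].
    by rewrite f'E //; exact: (implyP (H1 j)).
  by rewrite /f' jc; exact: (implyP (H2 j)).
exists f'; split=> [j k|i t /andP[ct tm]].
  have old_new j' k' : (chi j' < c)%N -> chi k' == c0 -> ~~ e (k', w k') (j', f j').
    by move=> jc _; have /forallP/(_ j')/implyP := w_alive k'; apply.
  rewrite !ltcS => /orP[jc|jc] /orP[kc|kc].
  - by rewrite !f'E //; apply: f_proper.
  - by rewrite f'E // /f' kc es; apply: old_new.
  - by rewrite (f'E k) // /f' jc; apply: old_new.
  - by have := w_proper j k; rewrite /q /f' /= jc kc.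
pose t' : 'I_m.+1 := Ordinal (tm : (t < m.+1)%N).
pose total := \sum_(x | alive f c (i, x)) phi t (i, x).
pose drop := \sum_(x | alive f c (i, x)) phi t (i, x) * D (i, x).
have start := f_lists i t; rewrite tm (ltnW ct) /= in start.
have {}start : n * nu t <= total - lam c * drop - eta * lam c * total.
  apply: le_trans (start isT) _; rewrite /total /drop !mulr_sumr -!sumrB.
  apply: ler_sum => x _; rewrite survivalS // /phi le_eqVlt; apply/orP; left; apply/eqP.
  ring.
have total_ge : n * beta <= total.
  apply: le_trans (_ : n * nu t <= _); first by rewrite ler_pM2l // nu_ge.
  apply: le_trans start _; rewrite -addrA gerDl -opprD oppr_le0.
  rewrite addr_ge0 ?mulr_ge0 ?sumr_ge0 // ?ltW // => x _; rewrite ?mulr_ge0 //;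
    exact: (phi0 t').
have loss : \sum_(x | alive f c (i, x)) phi t (i, x) *
    (\sum_(j | chi j == c0) (e (i, x) (j, w j))%:R) <= lam c * drop + eta * lam c * total.
  have := wY (i, t'); rewrite /mean /= ct => wYi.
  apply: le_trans (_ : l * \sum_j Y (i, t') j (w j) <= _).
    under eq_bigr do rewrite mulr_sumr.
    rewrite exchange_big big_mkcond mulr_sumr; apply: ler_sum => j _.
    rewrite /Y /= ct andbT; case: ifP => _; last by rewrite mulr0.
    by rewrite mulrC divfK // lt0r_neq0.
  apply: le_trans (ler_wpM2l (ltW l_gt0) wYi) _.
  rewrite -addrA mulrDr; apply: lerD.
    by rewrite mulrC divfK // lt0r_neq0.
  (* The error [4 * tau * M * l] equals [64 * K * n / (m%:R * beta) ^+ 2], and [m_large] brings it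
     below the slack. *)
  apply: le_trans (_ : eta * m%:R^-1 * (n * beta) <= _); last first.
    apply: ler_pM total_ge; [|by apply: mulr_ge0; apply: ltW|by rewrite ler_pM2l // lam_ge].
    by apply: mulr_ge0; [exact: ltW|rewrite invr_ge0 ltW].
  have -> : l * (2 * tau * M + 2 * tau * M) = 64 * K * (n / (m%:R * beta) ^+ 2).
    by rewrite /tau /M; field; rewrite !lt0r_neq0.
  apply: le_trans (ler_wpM2r _ m_large) _.
    by rewrite divr_ge0 ?exprn_ge0 // ltW.
  rewrite le_eqVlt; apply/orP; left; apply/eqP.
  by field; rewrite !lt0r_neq0.
apply: le_trans start _; rewrite -addrA -opprD.
apply: le_trans (_ : total - \sum_(x | alive f c (i, x)) phi t (i, x) *
    (\sum_(j | chi j == c0) (e (i, x) (j, w j))%:R) <= _).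
  by rewrite lerD2l lerN2.
rewrite /total -sumrB.
rewrite big_mkcond [leRHS]big_mkcond; apply: ler_sum => x _.
rewrite aliveE; case: (alive f c (i, x)) => //=.
have ph := phi0 t' (i, x).
(* A surviving vertex contributes no loss, and a lost one at least its whole weight. *)
case: forallP => [H|].
  rewrite big1 ?mulr0 ?subr0 // => j jc.
  by have /implyP/(_ jc)/negPf-> := H j.
move=> /forallP; rewrite negb_forall => /existsP[j]; rewrite negb_imply negbK => /andP[jc ej].
rewrite (bigD1 j) //= ej mulrDr mulr1 opprD addNKr oppr_le0.
by rewrite mulr_ge0 // sumr_ge0.
Qed.

Lemma class_colouring : has_transversal e.
Proof.
have [x _] : exists x : F, true.
  have : (0 < #|F|)%N by rewrite -(ltr_nat R).
  by move=> /card_gt0P[x _]; exists x.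
have all c : (c <= m)%N -> exists f, coloured f c.
  elim: c => [_|c IH cm]; first by exists (fun=> x); apply: coloured0.
  by have [f /colour_step] := IH (ltnW cm); apply.
have [f [f_proper _]] := all m (leqnn m).
by exists f => i j; apply: f_proper.
Qed.

End ClassColouring.

Lemma low_local_transversal (R : realType) (K beta C : R) :
  1 <= K -> 0 < beta < 1 -> 0 < C ->
  exists2 x0 : R, 1 <= x0 & forall x, x0 <= x ->
  forall (B F : finType) (e : rel (B * F)), block_graph e ->
  x ^+ 3 <= #|F|%:R <= 8 * x ^+ 3 ->
  bounded_graph e (K * #|F|%:R) ((1 - beta) * #|F|%:R ^+ 2) (C * x ^+ 2) ->
  has_transversal e.
Proof.
move=> K1 /andP[b0 b1] C0.
(* The margin [beta] loses [eta] twice: once inside [D], for the uneven distribution over the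
   classes, and once for deviations during the colouring. This leaves [1 - a = beta / 2]. *)
pose eta := beta / 4; pose a := 1 - beta / 2; pose K' := K + 1.
have eta0 : 0 < eta by rewrite divr_gt0.
have aE : 1 - a = beta / 2 by rewrite /a; lra.
have h0 : 0 < eta * (beta / 2) ^+ 3 by rewrite mulr_gt0 ?exprn_gt0 ?divr_gt0.
pose m := Num.bound (64 * K' / (eta * (beta / 2) ^+ 3)).
have m_large : 64 * K' < m%:R * (eta * (beta / 2) ^+ 3).
  rewrite -ltr_pdivrMr //; apply: archi_boundP; rewrite divr_ge0 ?(ltW h0) //.
  by rewrite /K'; lra.
have mR : 0 < m%:R :> R.
  by rewrite -(pmulr_lgt0 _ h0); apply: le_lt_trans m_large; rewrite /K'; lra.
have m0 : (0 < m)%N by rewrite -(ltr_nat R).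
have m1 : 1 <= m%:R :> R by rewrite ler1n.
have dK : 0 < eta / m%:R <= K.
  rewrite divr_gt0 //= ler_pdivrMr //; apply: le_trans (_ : 1 * 1 <= _).
    by rewrite /eta; lra.
  by apply: ler_pM.
have [x1 x11 x1P] := class_partition m0 K1 C0 dK.
pose tau : R := 16 * K' / (m%:R * (beta / 2)).
have K'0 : 0 < K' by rewrite /K'; lra.
have mb0 : 0 < m%:R * (beta / 2) by rewrite mulr_gt0 // divr_gt0.
have tau0 : 0 < tau by rewrite divr_gt0 // mulr_gt0.
have c0 : 0 < tau ^+ 2 / (4 * (m%:R * (beta / 2)) * C).
  by rewrite divr_gt0 ?exprn_gt0 // mulr_gt0 // mulr_gt0.
have [x2 x21 x2P] := exp_beats_pow (128 * K' * m.+1%:R / tau) 6 c0.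
exists (Num.max x1 x2) => [|x]; first by rewrite le_max x11.
rewrite ge_max => /andP[/[dup] /(le_trans x11) x_ge1 /x1P {}x1P /x2P {}x2P].
move=> B F e eB nx [eK eS eC].
have xp : 0 < x by apply: lt_le_trans x_ge1.
have [chi chiP] := x1P B F e eB nx eK eC.
have /andP[nx1 nx8] := nx.
set n : R := #|F|%:R in eK eS chiP nx1 nx8.
have n0 : 0 < n by apply: lt_le_trans nx1; apply: exprn_gt0.
have l0 : 0 < C * x ^+ 2 by rewrite mulr_gt0 // exprn_gt0.
pose D (v : B * F) : R := (deg e v)%:R / n + eta.
apply: (@class_colouring R B F e m chi D K' a eta (C * x ^+ 2)) => //.
- by rewrite /K'; lra.
- by rewrite /a; lra.
- by move=> v; rewrite /D addr_ge0 ?divr_ge0 // ltW.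
- move=> v; rewrite /D /K' -addrA; apply: lerD; last by rewrite /eta; lra.
  by rewrite ler_pdivrMr.
- move=> i; rewrite big_split /= big_split /= !sumr_const -[eta *+ _]mulr_natr -/n -mulr_suml.
  apply: le_trans (_ : (1 - beta) * n + eta * n + eta * n <= _).
    rewrite !lerD2r ler_pdivrMr //; apply: le_trans (eS i) _.
    by rewrite expr2 mulrA.
  by rewrite /a /eta; lra.
- move=> v c; apply: le_trans (chiP v c) _; rewrite -/n /D le_eqVlt; apply/orP; left; apply/eqP.
  by field; rewrite !lt0r_neq0.
- by move=> v; apply: le_trans (eK v) _; rewrite ler_pM2r // /K'; lra.
- by rewrite aE ltW.
- by rewrite /eta; lra.
rewrite -/n aE -/tau.
apply: le_trans (_ : 128 * K' * m.+1%:R * x ^+ 6 *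
  expR (- (tau ^+ 2 / (4 * (m%:R * (beta / 2)) * C) * x)) <= _).
  apply: ler_pM; [by rewrite !mulr_ge0 // ltW|exact: expR_ge0| |].
    have nn : n * n <= (8 * x ^+ 3) * (8 * x ^+ 3) by apply: ler_pM => //; apply: ltW.
    have -> : 2 * (n * (K' * n) * m.+1%:R) = n * n * (2 * K' * m.+1%:R) by ring.
    have -> : 128 * K' * m.+1%:R * x ^+ 6 =
      (8 * x ^+ 3) * (8 * x ^+ 3) * (2 * K' * m.+1%:R) by ring.
    by apply: ler_wpM2r => //; rewrite !mulr_ge0 // ltW.
  rewrite ler_expR lerN2.
  have -> : tau ^+ 2 * (n / (m%:R * (beta / 2) * (C * x ^+ 2))) / 4 =
    tau ^+ 2 / (4 * (m%:R * (beta / 2)) * C) * (n / x ^+ 2).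
    by move: mb0; move: (m%:R * (beta / 2)) => y y0; field; rewrite !lt0r_neq0.
  by rewrite ler_pM2l // ler_pdivlMr ?exprn_gt0.
move: x2P; set ex := expR _ => x2P.
have -> : 128 * K' * m.+1%:R * x ^+ 6 * ex =
     (128 * K' * m.+1%:R / tau * x ^+ 6 * ex) * tau.
  by field; apply: lt0r_neq0.
by rewrite -[leRHS]mul1r ler_pM2r.
Qed.

(** * Iterated shrinking of blocks of size [q * 8 ^ k] *)

Fixpoint octuple (q k : nat) : finType :=
  if k is k'.+1 then (octuple q k' * 'I_8)%type else 'I_q.

Lemma card_octuple q k : #|octuple q k| = (q * 8 ^ k)%N.
Proof.
elim: k => [|k IH] /=; first by rewrite card_ord muln1.
by rewrite card_prod card_ord IH expnSr mulnA.
Qed.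

Lemma octuple_transversal (R : realType) (K beta : R) : 1 <= K -> 0 < beta < 1 ->
  exists2 q1 : nat, (0 < q1)%N &
  forall (q0 q k : nat) (B : finType) (e : rel (B * octuple q k)),
  (q1 <= q0)%N -> (q0 ^ 3 <= q <= 8 * q0 ^ 3)%N -> block_graph e ->
  bounded_graph e (K * #|octuple q k|%:R) ((1 - beta) * #|octuple q k|%:R ^+ 2)
    (#|octuple q k|%:R / q0%:R) ->
  has_transversal e.
Proof.
move=> K1 /andP[b0 b1].
pose K' := K + 1; have K'1 : 1 <= K' by rewrite /K'; lra.
pose C := 16 * (K' + 1); have C0 : 0 < C by rewrite /C; lra.
have b2 : 0 < beta / 2 < 1 by lra.
have C8 : 0 < 8 * (C + 1) by lra.
have [x1 x11 x1P] := low_local_transversal K'1 b2 C8.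
have [x2 x21 x2P] := thinning_exists K'1.
(* The last two terms make the final error [C / q0%:R] at most 1 and at most [beta / 2]. *)
pose bnd := x1 + x2 + C + 2 * C / beta.
have Cb : 0 < 2 * C / beta by rewrite divr_gt0 // mulr_gt0.
pose q1 := Num.bound bnd.
have q1P : bnd < q1%:R by apply: archi_boundP; rewrite /bnd; lra.
exists q1 => [|q0 q k B e q01 /andP[q0q qq0] eB eb].
  by rewrite -(ltr_nat R); apply: lt_trans q1P; rewrite /bnd; lra.
have q0P : bnd < q0%:R by apply: lt_le_trans q1P _; rewrite ler_nat.
have [x1q x2q Cq Cbq] : [/\ x1 <= q0%:R, x2 <= q0%:R, C <= q0%:R & 2 * C / beta <= q0%:R].
  by move: q0P; rewrite /bnd => q0P; split; lra.
have q00 : 0 < q0%:R :> R by apply: lt_le_trans Cq.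
have {}q0q : q0%:R ^+ 3 <= q%:R :> R by rewrite -natrX ler_nat.
have {}qq0 : q%:R <= 8 * q0%:R ^+ 3 :> R by rewrite -natrX -natrM ler_nat.
pose X k : R := q0%:R * 2 ^+ k.
have X0 j : 0 < X j by rewrite mulr_gt0 // exprn_gt0.
pose n k : R := #|octuple q k|%:R.
have nS j : n j.+1 = 8 * n j by rewrite /n /= card_prod card_ord natrM mulrC.
have XS j : X j.+1 = 2 * X j by rewrite /X exprS mulrCA.
have nX j : X j ^+ 3 <= n j <= 8 * X j ^+ 3.
  elim: j => [|j /andP[IH1 IH2]].
    by rewrite /X /n /= card_ord mulr1 q0q.
  have X3 : X j.+1 ^+ 3 = 8 * X j ^+ 3 by rewrite XS exprMn -natrX.
  by rewrite X3 nS !ler_pM2l // IH1.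
(* The invariant carries a relative error [C / X k], where [X k] is the cube root of the block size
   up to a factor 2. A round halves [X] and so doubles this allowance, and the increase pays for the
   thinning. *)
have : bounded_graph e ((K + C / X k) * n k) ((1 - beta + C / X k) * n k ^+ 2)
    ((q0%:R^-1 + C / X k) * n k).
  have [eK eS eC] := eb; have CX : 0 <= C / X k by rewrite divr_ge0 // ltW.
  have n0 : 0 <= n k by [].
  split=> [v|i|v j].
  - by apply: le_trans (eK v) _; apply: ler_wpM2r => //; rewrite lerDl.
  - by apply: le_trans (eS i) _; apply: ler_wpM2r; rewrite ?exprn_ge0 // lerDl.
  - by apply: le_trans (eC v j) _; rewrite mulrC; apply: ler_wpM2r => //; rewrite lerDl.
elim: k e eB {eb} => [|k IH] e eB [eK eS eC].
  have X0E : X 0%N = q0%:R by rewrite /X mulr1.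
  have CX1 : C / X 0%N <= 1 by rewrite X0E ler_pdivrMr // mul1r.
  have CXb : C / X 0%N <= beta / 2.
    rewrite X0E ler_pdivrMr //; move: Cbq; rewrite ler_pdivrMr //; lra.
  have n0 : 0 <= n 0%N by [].
  apply: (x1P _ x1q) => //; first by rewrite -X0E; apply: nX.
  split=> [v|i|v j].
  - by apply: le_trans (eK v) _; apply: ler_wpM2r => //; rewrite /K'; lra.
  - by apply: le_trans (eS i) _; apply: ler_wpM2r; rewrite ?exprn_ge0 //; lra.
  - apply: le_trans (eC v j) _; have /andP[_] := nX 0%N; rewrite X0E => nq.
    apply: le_trans (ler_wpM2l _ nq) _.
      by rewrite addr_ge0 ?invr_ge0 ?divr_ge0 // ltW.
    rewrite le_eqVlt; apply/orP; left; apply/eqP; field; exact: lt0r_neq0.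
have [es eb] := eB.
have /andP[nX1 nX8] := nX k.+1.
have xq : x2 <= X k.+1.
  apply: le_trans x2q _; rewrite /X ler_peMr ?(ltW q00) // exprn_ege1 //.
  by rewrite (ler_nat _ 1).
have CX : C / X k.+1 <= 1.
  rewrite ler_pdivrMr // mul1r; apply: le_trans Cq _.
  by rewrite /X ler_peMr ?(ltW q00) // exprn_ege1 // (ler_nat _ 1).
have n0 : 0 <= n k by [].
have eK' v : (deg e v)%:R <= K' * (8 * n k).
  apply: le_trans (eK v) _; rewrite nS; apply: ler_wpM2r; last by rewrite /K'; lra.
  exact: mulr_ge0.
rewrite nS in nX1 nX8.
have [g [gK gS gC]] := x2P _ xq B _ e eB nX8 eK'.
(* The worst error is that of the block degree sums: per vertex, [2 * K' * X k.+1 ^+ 2] from the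
   choice of vertices and [2 * X k.+1 ^+ 2] from their new degrees. The value of [C] is fixed by
   this bound. *)
have key : 2 * (K' + 1) * X k.+1 ^+ 2 <= C / X k.+1 * n k.
  rewrite [leRHS]mulrAC ler_pdivlMr //.
  rewrite (_ : _ * X k.+1 = 2 * (K' + 1) * X k.+1 ^+ 3) /C; last by ring.
  apply: le_trans (ler_wpM2l _ nX1) _; last by lra.
  by rewrite mulr_ge0 //; move: K'1; lra.
have x2_0 : 0 <= X k.+1 ^+ 2 by apply: sqr_ge0.
have key2 : 2 * X k.+1 ^+ 2 <= C / X k.+1 * n k.
  apply: le_trans key; apply: ler_wpM2r => //; move: K'1; lra.
have CXS : C / X k = 2 * (C / X k.+1).
  by rewrite XS; field; apply: lt0r_neq0.
have [||f fP] := IH (relpre (thin g) e).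
- by split=> [v w|i y z] /=; [exact: es|exact: eb].
- rewrite CXS; split=> [v|i|v j].
  + apply: le_trans (gK v) _.
    have := eK (thin g v); rewrite nS => eKv.
    move: key2 eKv; move: (C / X k.+1) => r; lra.
  + apply: le_trans (ler_sum _ (fun y _ => gK (i, y))) _.
    rewrite big_split /= sumr_const -mulr_suml -[X in _ + X]mulr_natr -/(n k).
    have := gS i; have := eS i; rewrite nS -/(n k).
    move: (ler_wpM2r n0 key).
    move: (C / X k.+1) (X k.+1 ^+ 2) => r y.
    move: (\sum_y _) (\sum_z _) => s s' h1 h2 h3; nra.
  + apply: le_trans (gC v j) _.
    have := eC (thin g v) j; rewrite nS => eCv.
    move: key2 eCv; move: (C / X k.+1) (q0%:R^-1) => r r'; lra.
- by exists (fun i => (f i, g (i, f i))) => i j; exact: fP.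
Qed.

(** * Reduction to transversals *)

Lemma subset_of_smallest (T : finType) (A : {set T}) (f : T -> nat) (n : nat) :
  (n <= #|A|)%N ->
  exists S : {set T}, [/\ S \subset A, #|S| = n
    & forall x y, x \in S -> y \in A :\: S -> (f x <= f y)%N].
Proof.
elim: n => [_|n IH nA].
  by exists set0; split; rewrite ?sub0set ?cards0 // => x y; rewrite inE.
have [S [SA Sn Sf]] := IH (ltnW nA).
have /card_gt0P[z0 z0P] : (0 < #|A :\: S|)%N by rewrite cardsDS // Sn subn_gt0.
case: (arg_minnP f z0P) => z zP zmin.
have /setDP[zA zS] := zP.
exists (z |: S); split=> [||x y].
- by rewrite subUset sub1set zA.
- by rewrite cardsU1 zS Sn.
- rewrite !inE negb_or => /orP[/eqP->|xS] /andP[/andP[_ yS] yA].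
    by have yP : y \in A :\: S; [rewrite inE yS|exact: zmin].
  by apply: Sf => //; rewrite inE yS.
Qed.

(** A value on [S] is at most every value on [A :\: S], hence at most their average. This turns a
    bound on the average degree into one on the maximum degree, without raising the average. *)
Lemma smallest_values (R : realFieldType) (T : finType) (A S : {set T}) (f : T -> nat) (d : R) :
  S \subset A -> (forall x y, x \in S -> y \in A :\: S -> (f x <= f y)%N) ->
  (0 < #|A|)%N -> \sum_(x in A) (f x)%:R <= d * #|A|%:R ->
  \sum_(x in S) (f x)%:R <= d * #|S|%:R /\
  forall x, x \in S -> (f x)%:R * (#|A|%:R - #|S|%:R) <= d * #|A|%:R.
Proof.
move=> SA Sf A0 fA.
have cA : #|A|%:R = #|S|%:R + #|A :\: S|%:R :> R.
  by rewrite -natrD cardsDS // subnKC // subset_leq_card.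
have sA : \sum_(x in A) (f x)%:R = \sum_(x in S) (f x)%:R + \sum_(x in A :\: S) (f x)%:R :> R.
  by rewrite (big_setID S) /= (setIidPr SA).
have pt x : x \in S -> (f x)%:R * #|A :\: S|%:R <= \sum_(y in A :\: S) (f y)%:R :> R.
  move=> xS; rewrite mulr_natr -sumr_const; apply: ler_sum => y yP.
  by rewrite ler_nat; apply: Sf.
have AR : 0 < #|A|%:R :> R by rewrite ltr0n.
have all_ge0 (P : {set T}) : 0 <= \sum_(x in P) (f x)%:R :> R by apply: sumr_ge0.
split=> [|x xS]; last first.
  rewrite {1}cA addrAC subrr add0r; apply: le_trans (pt x xS) _.
  by apply: le_trans fA; rewrite sA lerDr.
have pts : (\sum_(x in S) (f x)%:R) * #|A :\: S|%:R <=
    #|S|%:R * \sum_(y in A :\: S) (f y)%:R :> R.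
  by rewrite mulr_suml [leRHS]mulr_natl -[leRHS]sumr_const; apply: ler_sum.
rewrite -(ler_pM2r AR) [leRHS]mulrAC.
apply: le_trans (_ : (\sum_(x in A) (f x)%:R) * #|S|%:R <= _).
  by rewrite sA cA; move: pts; lra.
by apply: ler_wpM2r.
Qed.

Lemma injection_onto (T F : finType) (S : {set T}) : #|F| = #|S| ->
  exists h : F -> T, injective h /\ h @: setT = S.
Proof.
move=> FS; exists (fun y => enum_val (cast_ord FS (enum_rank y))).
have inj : injective (fun y : F => enum_val (cast_ord FS (enum_rank y))).
  by move=> y z /enum_val_inj /cast_ord_inj /enum_rank_inj.
split=> //; apply/eqP; rewrite eqEcard card_imset // cardsT.
apply/andP; split; last by rewrite FS.
by apply/subsetP=> _ /imsetP[y _ ->]; apply: enum_valP.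
Qed.

(** With [k] the base 8 logarithm of [N %/ q0 ^ 3], rounding [N] down to a multiple of [8 ^ k] loses
    a proportion that is small for large [q0]. *)
Lemma octuple_size (N q0 : nat) : (0 < q0)%N -> (q0 ^ 3 <= N)%N ->
  exists q k, [/\ (q0 ^ 3 <= q <= 8 * q0 ^ 3)%N, (q * 8 ^ k <= N)%N
    & (N < q.+1 * 8 ^ k)%N].
Proof.
move=> q00 q0N; have q30 : (0 < q0 ^ 3)%N by rewrite expn_gt0 q00.
have N0 : (0 < N %/ q0 ^ 3)%N by rewrite divn_gt0.
pose k := trunc_log 8 (N %/ q0 ^ 3).
have /andP[k1 k2] : (8 ^ k <= N %/ q0 ^ 3 < 8 ^ k.+1)%N by apply: trunc_log_bounds.
have k80 : (0 < 8 ^ k)%N by rewrite expn_gt0.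
exists (N %/ 8 ^ k)%N, k; split; rewrite ?leq_trunc_div ?ltn_ceil //.
move: k1 k2; rewrite leq_divRL // ltn_divLR // => k1 k2.
rewrite leq_divRL // mulnC k1 /= ltnW // ltn_divLR //.
by rewrite mulnAC -expnS.
Qed.

Lemma blowup_of_choice (T : finType) (e : rel T) (r s : nat) (V : 'I_r -> {set T})
    (h : 'I_r -> 'I_s -> T) :
  (forall i j : 'I_r, i != j -> [disjoint V i & V j]) ->
  (forall i a, h i a \in V i) -> (forall i, injective (h i)) ->
  (forall i a j b, ~~ e (h i a) (h j b)) ->
  transversal_blowup e V s [set h p.1 p.2 | p : 'I_r * 'I_s].
Proof.
move=> dV hV hI he; split=> [_ _ /imsetP[p _ ->] /imsetP[q _ ->]|i]; first exact: he.
rewrite (_ : _ :&: _ = h i @: setT); first by rewrite card_imset // cardsT card_ord.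
apply/setP=> x; rewrite inE; apply/andP/imsetP => [[/imsetP[[j a] _ ->] /= ji]|[a _ ->]].
  have [ij|/dV /disjointFr] := eqVneq j i; first by exists a => //; rewrite ij.
  by move=> /(_ _ (hV j a)); rewrite ji.
by split=> //; apply/imsetP; exists (i, a).
Qed.

(** * The blow-up graph *)

Section Blowup.
Variables (T F : finType) (e : rel T) (r s : nat) (V : 'I_r -> {set T}) (h : 'I_r -> F -> T).
Hypothesis e_simple : simple_graph e.
Hypothesis V_part : multipartition e V.
Hypothesis h_inj : forall i, injective (h i).
Hypothesis hV : forall i y, h i y \in V i.

Let B := ('I_r * 'I_s)%type.
Let H (p : B * F) : T := h p.1.1 p.2.

(* The s copies of a block are joined by the identity matching, so that a
   transversal picks s distinct vertices from the block. *)
Definition blowup : rel (B * F) :=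
  fun p p' => e (H p) (H p') || (H p == H p') && (p.1.2 != p'.1.2).

Let H_block p p' : H p = H p' -> p.1.1 = p'.1.1 /\ p.2 = p'.2.
Proof.
have [_ dV _] := V_part; case: p p' => [[i a] y] [[j b] z]; rewrite /H /= => hh.
have ij : i = j.
  apply/eqP; apply: contraT => /dV /disjointFr /(_ (hV i y)).
  by rewrite hh hV.
by rewrite -ij in hh *; split=> //; apply: h_inj hh.
Qed.

Lemma blowup_block_graph : block_graph blowup.
Proof.
have [es _] := e_simple; have [_ _ iV] := V_part.
split=> [p p'|[i a] x y]; first by rewrite /blowup es [H p == _]eq_sym [p.1.2 == _]eq_sym.
by rewrite /blowup /= eqxx andbF orbF; apply: iV; exact: hV.
Qed.

(** A neighbour of [p] is a copy of a neighbour of [H p] or of [H p] itself; the latter accounts for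
    the successor. *)
Lemma blowup_deg p : (deg blowup p <= s * (deg e (H p)).+1)%N.
Proof.
pose G (p' : B * F) := (H p', p'.1.2).
have G_inj : injective G.
  move=> p1 p2 [/H_block [h1 h2] h3]; case: p1 p2 h1 h2 h3 => [[i a] y] [[j b] z] /=.
  by move=> -> -> ->.
rewrite /deg -(card_imset _ G_inj).
apply: leq_trans (_ : #|setX (H p |: [set w | e (H p) w]) [set: 'I_s]| <= _)%N.
  apply/subset_leq_card/subsetP=> _ /imsetP[p' + ->].
  by rewrite !inE andbT eq_sym => /orP[->|/andP[-> _]]; rewrite ?orbT.
rewrite cardsX cardsT card_ord mulnC leq_mul2l cardsU1 -add1n leq_add2r.
by rewrite leq_b1 orbT.
Qed.

Lemma blowup_block_deg p j : (block_deg blowup p j <= (deg_in e (H p) (V j.1)).+1)%N.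
Proof.
rewrite /block_deg /deg_in -(card_imset _ (h_inj (i := j.1))).
apply: leq_trans (_ : #|H p |: [set w in V j.1 | e (H p) w]| <= _)%N.
  apply/subset_leq_card/subsetP=> _ /imsetP[y + ->].
  rewrite !inE hV /blowup => /orP[ey|/andP[/eqP py _]]; first by rewrite ey orbT.
  by rewrite py /H /= eqxx.
by rewrite cardsU1 -add1n leq_add2r leq_b1.
Qed.

Lemma transversal_blowup_of : has_transversal blowup ->
  exists S, transversal_blowup e V s S.
Proof.
have [_ dV _] := V_part; case=> f fP.
exists [set h p.1 (f (p.1, p.2)) | p : 'I_r * 'I_s].
apply: (blowup_of_choice (h := fun i a => h i (f (i, a)))) => // [i a b hab|i a j b].
  apply/eqP; apply: contraT => ab.
  by have := fP (i, a) (i, b); rewrite /blowup /H /= hab eqxx ab orbT.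
by have := fP (i, a) (j, b); rewrite /blowup negb_or => /andP[].
Qed.

End Blowup.

Lemma octuple_count (R : realFieldType) (q0 q k N : nat) :
  (0 < q0)%N -> (q0 ^ 3 <= q)%N -> (N < q.+1 * 8 ^ k)%N ->
  N%:R <= (q * 8 ^ k)%:R * (1 + q0%:R^-1) :> R.
Proof.
move=> q00 q0q Nq; have q0R : 0 < q0%:R :> R by rewrite ltr0n.
rewrite mulrDr mulr1; apply: le_trans (_ : (q * 8 ^ k + 8 ^ k)%:R <= _).
  by rewrite ler_nat ltnW // -mulSnr.
rewrite natrD lerD2l ler_pdivlMr // -natrM ler_nat mulnC leq_mul2r.
apply/orP; right; apply: leq_trans q0q.
by rewrite expnS leq_pmulr // expn_gt0 q00.
Qed.

(* For D >= 1 the premise [D < 1 -> _] is vacuous. For D < 1 it is a necessary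
   condition for the conclusion that thickness alone does not give: edgeless
   blocks of one vertex, with s = 2 and D small, meet every other premise. *)
Theorem theorem4p8 (R : realType) (s : nat) (s_gt0 : (0 < s)%N)
    (eps : R) (eps_gt0 : 0 < eps) :
  exists2 gamma : R, 0 < gamma &
    forall (D : R) (T : finType) (e : rel T) (r : nat) (V : 'I_r -> {set T}),
      simple_graph e ->
      multipartition e V ->
      max_avg_deg R e V <= D ->
      (local_deg e V)%:R <= gamma * D ->
      thick V ((s%:R + eps) * D) ->
      (D < 1 -> forall i : 'I_r, (s <= #|V i|)%N) ->
      exists S : {set T}, transversal_blowup e V s S.
Proof.
have sR : 1 <= s%:R :> R by rewrite ler1n.
(* Chosen so that [(1 - beta) * (s%:R + eps / 4) = s%:R + eps / 8], which keeps [eps / 8 * D] free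
   for lower-order terms. *)
pose beta := eps / 8 / (s%:R + eps / 4).
have s4 : 0 < s%:R + eps / 4 by lra.
have b01 : 0 < beta < 1.
  by rewrite /beta !divr_gt0 //= ltr_pdivrMr // mul1r; lra.
have /andP[b0 b1] := b01.
have bE : beta * (s%:R + eps / 4) = eps / 8 by rewrite /beta divfK // lt0r_neq0.
(* Cutting a block from at least [(s%:R + eps) * D] to at most [(s%:R + eps / 2) * D] vertices
   discards a proportion of at least [K0^-1], so the kept degrees are at most [K0 * D]. *)
pose K0 := 2 * (s%:R + eps) / eps.
have K00 : 0 <= K0 by rewrite divr_ge0 ?(ltW eps_gt0) //; lra.
have K1 : 1 <= K0 + 1 by lra.
have [q1 q10 q1P] := octuple_transversal K1 b01.
pose q0 := (q1 + Num.bound beta^-1)%N.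
have q1q0 : (q1 <= q0)%N by apply: leq_addr.
have q00 : (0 < q0)%N by apply: leq_trans q1q0.
have q0R : 0 < q0%:R :> R by rewrite ltr0n.
have q0b : q0%:R^-1 <= beta.
  rewrite -[leRHS]invrK lef_pV2 ?posrE ?invr_gt0 //.
  apply: le_trans (ltW (archi_boundP _)) _; first by rewrite invr_ge0 ltW.
  by rewrite ler_nat leq_addl.
(* In order, the terms serve for the local degree bound [n / q0%:R], for [N >= q0 ^ 3], for
   [D >= 1], for the rounding of [x] to [N], and for the [s] additional neighbours in the
   blow-up. *)
pose D0 := 2 * q0%:R + (q0 ^ 3)%:R + 1 + 8 / eps + 8 * s%:R / eps.
have e80 : 0 < 8 / eps by rewrite divr_gt0.
have es0 : 0 <= 8 * s%:R / eps by rewrite divr_ge0 ?(ltW eps_gt0) // mulr_ge0.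
have D00 : 0 < D0 by rewrite /D0; have : 0 <= (q0 ^ 3)%:R :> R by []; lra.
exists D0^-1 => [|D T e r V e_simple V_part avgD localD thickV smallD]; first by rewrite invr_gt0.
have [es _] := e_simple; have [UV dV iV] := V_part.
have cover v : exists i, v \in V i.
  have : v \in \bigcup_(i < r) V i by rewrite UV.
  by move=> /bigcupP[i _ vi]; exists i.
have local_le v i : (deg_in e v (V i) <= local_deg e V)%N.
  rewrite /local_deg (bigD1 v) //= leq_max; apply/orP; left.
  by rewrite (bigD1 i) //= leq_max leqnn.
(* Below [D0] the local degree is less than 1, so there are no edges and any [s] vertices of each
   block will do. *)
have [Dsmall|Dlarge] := ltP (D0^-1 * D) 1.
  have no_edge v w : ~~ e v w.
    have loc0 : (local_deg e V = 0)%N.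
      apply/eqP; rewrite -leqn0 -ltnS -(ltr_nat R); exact: le_lt_trans localD _.
    have [i wi] := cover w; apply/negP=> evw.
    have := local_le v i; rewrite loc0 leqn0 cards_eq0 => /eqP/setP/(_ w).
    by rewrite !inE wi evw.
  have sV i : (s <= #|V i|)%N.
    have [/smallD //|D1] := ltP D 1.
    rewrite -(ler_nat R); apply: le_trans (thickV i).
    by apply: le_trans (_ : (s%:R + eps) * 1 <= _); [lra|rewrite ler_pM2l //; lra].
  pose h i (a : 'I_s) := enum_val (widen_ord (sV i) a).
  exists [set h p.1 p.2 | p : 'I_r * 'I_s]; apply: blowup_of_choice => //.
    by move=> i a; apply: enum_valP.
  by move=> i a b /enum_val_inj /(congr1 val) /= /val_inj.
have {}Dlarge : D0 <= D by move: Dlarge; rewrite mulrC ler_pdivlMr // mul1r.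
have [D1 D2 D3 D4 D5] : [/\ 1 <= D, 2 * q0%:R <= D, (q0 ^ 3)%:R + 1 <= D, 8 / eps <= D
    & 8 * s%:R / eps <= D].
  by move: Dlarge; rewrite /D0; have : 0 <= (q0 ^ 3)%:R :> R by []; split; lra.
have D_gt0 : 0 < D by lra.
move: D4 D5; rewrite !ler_pdivrMr // => D4 D5.
(* Half of [eps] is spent on bounding the maximum degree; rounding to a size [q * 8 ^ k] spends at
   most another quarter. *)
pose x := (s%:R + eps / 2) * D.
have xD : D <= x by rewrite /x ler_peMl ?ltW //; lra.
have x0 : 0 <= x by lra.
pose N := Num.truncn x.
have /andP[Nx xN] : N%:R <= x < N.+1%:R by apply: truncn_itv.
have q0N : (q0 ^ 3 <= N)%N by rewrite -(ler_nat R) -natr1 in xN *; lra.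
have [q [k [qq0 qkN Nqk]]] := octuple_size q00 q0N.
set F := octuple q k; pose n : R := #|F|%:R.
have nE : n = (q * 8 ^ k)%:R by rewrite /n card_octuple.
have nx : n <= x by apply: le_trans Nx; rewrite nE ler_nat.
have n_ge : (s%:R + eps / 4) * D <= n.
  have /andP[q0q _] := qq0.
  have := octuple_count R q00 q0q Nqk; rewrite -nE => Nn.
  have nb : n * q0%:R^-1 <= n * beta by apply: ler_wpM2l.
  have bp : 0 < 1 + beta by lra.
  rewrite -(ler_pM2l bp).
  have -> : (1 + beta) * ((s%:R + eps / 4) * D) = (s%:R + eps / 4 + eps / 8) * D.
    by rewrite -bE; ring.
  rewrite -natr1 in xN; move: xN Nn nb D4; rewrite /x; lra.
have nD : D <= n by apply: le_trans n_ge; rewrite ler_peMl ?ltW //; lra.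
have nsD : s%:R * D <= n.
  by apply: le_trans n_ge; rewrite ler_pM2r //; lra.
have pick i : exists h : F -> T, [/\ injective h, forall y, h y \in V i,
    \sum_y (deg e (h y))%:R <= D * n & forall y, (deg e (h y))%:R <= K0 * D].
  have VR := thickV i.
  have V0 : 0 < #|V i|%:R :> R by apply: lt_le_trans VR; rewrite mulr_gt0 //; lra.
  have FV : (#|F| <= #|V i|)%N.
    rewrite -(ler_nat R); apply: le_trans nx _; apply: le_trans VR.
    by rewrite /x ler_pM2r //; lra.
  have [S [SV SF Ssm]] := subset_of_smallest (deg e) FV.
  have sumV : \sum_(v in V i) (deg e v)%:R <= D * #|V i|%:R.
    rewrite -ler_pdivrMr //; apply: le_trans avgD.
    exact: (le_bigmax _ (fun i => avg_deg R e (V i)) i).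
  have V0' : (0 < #|V i|)%N by rewrite -(ltr_nat R).
  have [sumS maxS] := smallest_values SV Ssm V0' sumV.
  have [h [h_inj hS]] := injection_onto (esym SF).
  have hinS y : h y \in S by rewrite -hS imset_f.
  exists h; split=> // [y||y].
  - exact: (subsetP SV).
  - move: sumS; rewrite SF -hS big_imset /=; last by move=> a b _ _; apply: h_inj.
    by rewrite (eq_bigl predT) // => y; rewrite inE.
  - have := maxS _ (hinS y); rewrite SF -/n => dV_le.
    have gap : #|V i|%:R * eps <= 2 * (s%:R + eps) * (#|V i|%:R - n).
      have s2 : 0 <= 2 * (s%:R + eps) by lra.
      have s3 : 0 <= 2 * s%:R + eps by lra.
      have n_le := ler_wpM2l s2 nx; have V_ge := ler_wpM2l s3 VR.
      move: n_le V_ge; rewrite /x; lra.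
    rewrite /K0 mulrAC ler_pdivlMr // -(ler_pM2r V0).
    have d_ge0 : 0 <= (deg e (h y))%:R :> R by [].
    apply: le_trans (_ : (deg e (h y))%:R * (2 * (s%:R + eps) * (#|V i|%:R - n)) <= _).
      by rewrite -[leLHS]mulrA [eps * _]mulrC; apply: ler_wpM2l.
    have s2 : 0 <= 2 * (s%:R + eps) by lra.
    have := ler_wpM2l s2 dV_le; lra.
have [h hP] := fin_all_exists pick.
have h_inj i : injective (h i) by have [] := hP i.
have hV i y : h i y \in V i by have [_ ] := hP i.
apply: (transversal_blowup_of V_part hV).
apply: (q1P q0 q k _ _ q1q0 qq0); first exact: (blowup_block_graph _ e_simple V_part hV).
rewrite -/F -/n; split=> [[[i a] y]|[i a]|p j].
- have [_ _ _ hK] := hP i.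
  apply: le_trans (_ : (s * (deg e (h i y)).+1)%:R <= _).
    by rewrite ler_nat; apply: (blowup_deg V_part h_inj hV).
  rewrite natrM -natr1 mulrDr mulr1 [leRHS]mulrDl mul1r; apply: lerD; last first.
    by apply: le_trans nsD; rewrite ler_peMr.
  apply: le_trans (_ : s%:R * (K0 * D) <= _); first by apply: ler_wpM2l.
  by rewrite mulrCA; apply: ler_wpM2l.
- have [_ _ hS _] := hP i.
  apply: le_trans (_ : \sum_y (s * (deg e (h i y)).+1)%:R <= _).
    by apply: ler_sum => y _; rewrite ler_nat; apply: (blowup_deg V_part h_inj hV).
  under eq_bigr do rewrite natrM -natr1.
  rewrite -mulr_sumr big_split /= sumr_const -/n.
  apply: le_trans (_ : s%:R * (D * n + n) <= _).
    by apply: ler_wpM2l => //; rewrite lerD2r.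
  have -> : s%:R * (D * n + n) = (s%:R * D + s%:R) * n by ring.
  rewrite expr2 mulrA; apply: ler_wpM2r => //.
  apply: le_trans (_ : (1 - beta) * ((s%:R + eps / 4) * D) <= _); last first.
    by apply: ler_wpM2l => //; lra.
  have -> : (1 - beta) * ((s%:R + eps / 4) * D) = (s%:R + eps / 4 - eps / 8) * D.
    by rewrite -bE; ring.
  move: D5; lra.
- apply: le_trans (_ : (local_deg e V).+1%:R <= _).
    rewrite ler_nat; apply: leq_trans (blowup_block_deg e h_inj hV p j) _.
    by rewrite ltnS local_le.
  rewrite -natr1 ler_pdivlMr //; apply: le_trans nD.
  have : (local_deg e V)%:R * q0%:R <= D / 2.
    apply: le_trans (ler_wpM2r (ltW q0R) localD) _.
    have D0q : D0^-1 * q0%:R <= 2^-1.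
      rewrite mulrC ler_pdivrMr //; move: (ler0n R (q0 ^ 3)); rewrite /D0; lra.
    by rewrite mulrAC mulrC ler_pM2l.
  lra.
Qed.
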